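(* Let $\vartheta^*\in(0,1)$ and $k_n^*=\lfloor n\vartheta^*\rfloor$. Consider the functional linear model $Y_i=\alpha+\langle X_i,\beta\rangle+\varepsilon_i$, $i=1,\dots,n$, with estimators $\hat\alpha,\hat\beta$ and change point estimator $\hat\vartheta_n$ as described in the context. Assume: (i) $|\hat\alpha-\alpha|=o_{\mathbb{P}}(1)$ and $\|\hat\beta-\beta\|=o_{\mathbb{P}}(1)$ as $n\to\infty$; (ii) $\varepsilon_1,\dots,\varepsilon_{k_n^*}$ are iid with cumulative distribution function $F_1$, and $\varepsilon_{k_n^*+1},\dots,\varepsilon_n$ are iid with cumulative distribution function $F_2\ne F_1$, where $F_1$ and $F_2$ are Hölder-continuous of order $\gamma_1,\gamma_2\in(0,1]$ with Hölder constants $c_1,c_2$, respectively; (iii) with $P_1$ the distribution of $(X_1,\varepsilon_1)$ (before the change) and $P_2$ the distribution of $(X_n,\varepsilon_n)$ (after the change), for both $P=P_1$ and $P=P_2$ it holds that $\mathbb{P}(\hat\beta-\beta\in\mathcal{B})\to1$ as $n\to\infty$ for a class $\mathcal{B}\subset\mathcal{H}$ such that the function class $$\mathcal{F}=\left\{(x,e)\mapsto I\{e\le v+\langle x,b\rangle\}\mid v\in\mathbb{R},\,b\in\mathcal{B}\right\}$$ is $P$-Donsker. Then the change point estimator is consistent, i.e. $$|\hat\vartheta_n-\vartheta^*|=o_{\mathbb{P}}(1).$$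
   Context: Setting. $\mathcal{H}$ is a separable Hilbert space with inner product $\langle\cdot,\cdot\rangle$, norm $\|\cdot\|$ and Borel sigma-field. $(X_i,Y_i)$, $i=1,\dots,n$, are independent $(\mathcal{H}\times\mathbb{R})$-valued random variables on a common probability space with probability measure $\mathbb{P}$, satisfying $Y_i=\alpha+\langle X_i,\beta\rangle+\varepsilon_i$ with parameters $\alpha\in\mathbb{R}$, $\beta\in\mathcal{H}$. The covariates $X_1,\dots,X_n$ are iid with $E\|X_i\|<\infty$; the errors $\varepsilon_1,\dots,\varepsilon_n$ are independent, centered, and independent of the covariates (the errors and data may depend on $n$, which is suppressed in the notation; $\vartheta^*,F_1,F_2,\alpha,\beta$ are fixed). $\hat\alpha$ and $\hat\beta$ are estimators, based on the whole sample $(X_i,Y_i)$, $i=1,\dots,n$, of $\alpha$ and $\beta$, with values in $\mathbb{R}$ and $\mathcal{H}$. Residuals: $\hat\varepsilon_i=Y_i-\hat\alpha-\langle X_i,\hat\beta\rangle$. Process and estimator. For $t\in[0,1]$, $z\in\mathbb{R}$, $$\hat G_n(t,z)=\frac{\lfloor nt\rfloor(n-\lfloor nt\rfloor)}{n^{3/2}}\left(\hat F_{\lfloor nt\rfloor}(z)-\tilde F_{\lfloor nt\rfloor}(z)\right),$$ $$\hat F_k(z)=\frac1k\sum_{i=1}^k I\{\hat\varepsilon_i\le z\},\qquad \tilde F_k(z)=\frac1{n-k}\sum_{i=k+1}^n I\{\hat\varepsilon_i\le z\},$$ with $\hat G_n(t,z)=0$ when $\lfloor nt\rfloor\in\{0,n\}$.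 The change point estimator is $$\hat\vartheta_n=\min\Big\{t\in[0,1]:\ \sup_{z\in\mathbb{R}}|\hat G_n(t,z)|=\sup_{t'\in[0,1]}\sup_{z\in\mathbb{R}}|\hat G_n(t',z)|\Big\}.$$ *)

(* Defs.v *)
From HB Require Import structures.
From mathcomp Require Import all_boot all_order all_algebra.
From mathcomp Require Import all_classical all_reals all_analysis.
Import Order.TTheory GRing.Theory Num.Theory.
Import numFieldNormedType.Exports.

Set Implicit Arguments.
Unset Strict Implicit.
Unset Printing Implicit Defensive.

Local Open Scope classical_set_scope.
Local Open Scope ring_scope.

Notation borel T := (g_sigma_algebraType (@open T)).

Definition separable (T : topologicalType) :=
  exists2 S : set T, countable S & dense S.

Section random_elements.
Context {d} {T : measurableType d} {R : realType} (P : probability T R).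

(* Intended for sigma-algebras: these contain setT, so the product rule over
   all of I yields the one over every subfamily. *)
Definition mutually_independent (I : finType) (G : I -> set_system T) :=
  forall A : I -> set T, (forall i, G i (A i)) ->
    P (\bigcap_i A i) = (\prod_i P (A i))%E.

Definition independent (G1 G2 : set_system T) :=
  forall A B, G1 A -> G2 B -> P (A `&` B) = (P A * P B)%E.

Definition identically_distributed {d'} {T' : measurableType d'}
    (X Y : {RV P >-> T'}) :=
  forall A, measurable A -> distribution P X A = distribution P Y A.

Definition little_o_P (Z : nat -> T -> R) :=
  forall e : R, 0 < e -> P [set w | e < `|Z n w|] @[n --> \oo] --> 0%E.

End random_elements.

Definition hoelder_continuous {R : realType} (g c : R) (F : R -> R) :=
  forall x y, `|F x - F y| <= c * `|x - y| `^ g.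

Section power_probability.
Context {d} {T : measurableType d} {R : realType} (P : probability T R).

Definition tcons n (x : T * n.-tuple T) : n.+1.-tuple T :=
  [tuple of x.1 :: x.2].

Lemma measurable_tcons n : measurable_fun setT (@tcons n).
Proof. exact: (measurable_cons measurable_fst measurable_snd). Qed.

HB.instance Definition _ n :=
  isMeasurableFun.Build _ _ _ _ (@tcons n) (@measurable_tcons n).

(* The n-fold product P^n. *)
Fixpoint power_probability n : probability (n.-tuple T) R :=
  if n is m.+1 then distribution (P \x power_probability m)%E (@tcons m)
  else \d_([tuple] : 0.-tuple T).

Lemma power_probability_box n (A : 'I_n -> set T) :
  (forall i, measurable (A i)) ->
  power_probability n [set s | forall i, A i (tnth s i)] = (\prod_i P (A i))%E.
Proof.
elim: n A => [|n IH] A mA.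
  by rewrite big_ord0 /= diracE mem_set// => -[].
rewrite big_ord_recl -IH// -product_measure1E//.
  rewrite /= /distribution /pushforward; congr ((_ \x _)%E _); apply/seteqP; split => -[x s] /=.
    move=> h; split=> [|i]; first by have := h ord0; rewrite tnth0.
    by have := h (lift ord0 i); rewrite tnthS.
  move=> [h0 h] i; case: (unliftP ord0 i) => [j|] ->; first by rewrite tnthS.
  by rewrite tnth0.
rewrite (_ : [set _ | _] = \bigcap_(i in [set: 'I_n])
    ((fun s : n.-tuple T => tnth s i) @^-1` A (lift ord0 i))).
  apply: fin_bigcap_measurable=> // i _.
  by rewrite -[X in measurable X]setTI; exact: measurable_tnth.
by apply/seteqP; split => s /= h i; [move=> _|]; exact: h.
Qed.

End power_probability.

Section weak_convergence.
Context {R : realType}.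

(* E^* Z is the infimum of E U over the measurable majorants U whose expectation
   exists; restricting to integrable U does not change the infimum, as one sees
   by truncating U from below. *)
Definition outer_expectation d (T : measurableType d) (P : probability T R)
    (Z : T -> R) : \bar R :=
  ereal_inf [set \int[P]_x U x | U in
    [set U : T -> \bar R | P.-integrable setT U /\ forall x, (Z x)%:E <= U x]]%E.

(* Weak convergence in the sense of Hoffmann-Joergensen: the Z n need not be
   measurable and may live on different probability spaces. *)
Definition weak_cvg (D : ptopologicalType) (d : nat -> measure_display)
    (T : forall n, measurableType (d n)) (P : forall n, probability (T n) R)
    (Z : forall n, T n -> D) (mu : probability (borel D) R) :=
  forall h : D -> R, continuous h -> bounded_fun h ->
    outer_expectation (P n) (h \o @Z n) @[n --> \oo]
      --> (\int[mu]_z (h z)%:E)%E.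

Definition tight (D : ptopologicalType) (mu : probability (borel D) R) :=
  forall e : R, 0 < e -> exists2 K : set D, compact K & ((1 - e)%:E <= mu K)%E.

End weak_convergence.

(* The bounded functions on I, with the topology of uniform convergence. *)
Definition bounded_functions (R : realType) (I : choiceType) :=
  [set z : {uniform I -> R} | bounded_fun (z : I -> R)].

Definition ell_infty (R : realType) (I : choiceType) : Type :=
  set_type (@bounded_functions R I).

Section ell_infty.
Variables (R : realType) (I : choiceType).

Lemma bounded_functions0 : bounded_functions (fun _ : I => 0 : R).
Proof. by exists 0; split=> // M M0 x _ /=; rewrite normr0 ltW. Qed.

HB.instance Definition _ := Topological.on (ell_infty R I).
HB.instance Definition _ := isPointed.Build (ell_infty R I)
  (exist (fun z => z \in _) _ (mem_set bounded_functions0)).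

End ell_infty.

Section donsker.
Context {d} {T : measurableType d} {R : realType} (P : probability T R).

Definition empirical_process n (s : n.-tuple T) (f : T -> R) : R :=
  Num.sqrt n%:R * (n%:R^-1 * (\sum_(i < n) f (tnth s i)) - \int[P]_x f x).

(* F is P-Donsker when the empirical process of n iid draws from P, which are the
   coordinates of P^n, is a map into ell_infty F which converges weakly to
   a tight Borel law. *)
Definition donsker (F : set (T -> R)) :=
  (forall f, F f -> P.-integrable setT (EFin \o f)) /\
  exists (G : forall n, n.-tuple T -> ell_infty R F)
    (mu : probability (borel (ell_infty R F)) R),
  [/\ forall n s (f : F), set_val (G n s) f = empirical_process s (set_val f),
      weak_cvg (power_probability P) G mu
    & tight mu].

End donsker.

Lemma sup_max (R : realType) (E : set R) x : E x -> ubound E x -> sup E = x.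
Proof.
move=> Ex Eub; apply/le_anti; rewrite ge_sup//=; last by exists x.
by apply: ub_le_sup => //; exists x.
Qed.

Lemma inf_min (R : realType) (E : set R) x : E x -> lbound E x -> inf E = x.
Proof.
move=> Ex Elb; apply/le_anti; rewrite lb_le_inf//=; last by exists x.
by rewrite andbT; apply: ge_inf => //; exists x.
Qed.

Section change_point.
Context {R : realType}.

Section estimator.
Variables (n : nat) (r : 'I_n -> R).

(* The i-th observation is indexed by i - 1 : 'I_n, so that the first k residuals
   are the r i with i < k. *)
Definition Fhat (k : nat) (z : R) : R :=
  k%:R^-1 * \sum_(i < n | (i < k)%N) (r i <= z)%R%:R.

Definition Ftilde (k : nat) (z : R) : R :=
  (n - k)%:R^-1 * \sum_(i < n | (k <= i)%N) (r i <= z)%R%:R.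

(* The first factor vanishes for k = 0 and for k = n. *)
Definition Ghat (t z : R) : R :=
  let k := Num.truncn (n%:R * t) in
  k%:R * (n - k)%:R / n%:R `^ (3 / 2) * (Fhat k z - Ftilde k z).

Definition supGhat (t : R) : R := sup [set `|Ghat t z| | z in [set: R]].

Definition Ghat_maximizers : set R :=
  [set t | 0 <= t <= 1 /\ supGhat t = sup [set supGhat s | s in `[0, 1]%classic]].

(* This infimum is attained, see change_point_estimator_min. *)
Definition change_point_estimator : R := inf Ghat_maximizers.

End estimator.

Lemma change_point_estimator_min n (r : 'I_n -> R) :
  let m := change_point_estimator r in
  Ghat_maximizers r m /\ lbound (Ghat_maximizers r) m.
Proof.
pose phi k z : R := k%:R * (n - k)%:R / n%:R `^ (3 / 2) * (Fhat r k z - Ftilde r k z).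
pose g (k : nat) := sup [set `|phi k z| | z in [set: R]].
have supE t : supGhat r t = g (Num.truncn (n%:R * t)) by [].
have [j _ jmax] := @arg_maxP _ _ 'I_n.+1 ord0 xpredT (fun i => g i) isT.
pose M := g j.
have exk : exists k : nat, (k <= n)%N && (g k == M).
  by exists j; rewrite eqxx -ltnS ltn_ord.
case: (ex_minnP exk) => k /andP[kn /eqP gk] kmin.
pose t0 : R := k%:R / n%:R.
have nt0 : n%:R * t0 = k%:R.
  rewrite /t0; have [n0|n0] := eqVneq n 0%N.
    by move: kn; rewrite [in (k <= n)%N]n0 leqn0 => /eqP ->; rewrite mul0r mulr0.
  by rewrite mulrC divfK// pnatr_eq0.
have t01 : 0 <= t0 <= 1.
  rewrite divr_ge0//=; have [n0|n0] := eqVneq n 0%N.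
    by rewrite /t0 n0 invr0 mulr0.
  by rewrite ler_pdivrMr ?ltr0n ?lt0n// mul1r ler_nat.
have trn t : 0 <= t <= 1 -> (Num.truncn (n%:R * t : R) <= n)%N.
  move=> /andP[t_ge0 t1]; rewrite -(ler_nat R).
  apply: (@le_trans _ _ (n%:R * t)); last by rewrite ler_piMr.
  by rewrite truncn_le mulr_ge0.
have supM : sup [set supGhat r s | s in `[0, 1]%classic] = M.
  apply: sup_max.
    exists t0; first by rewrite /= in_itv.
    by rewrite supE nt0 natrK.
  move=> _ [s /= + <-]; rewrite in_itv/= => /trn; rewrite -ltnS => s_lt.
  by rewrite supE; exact: (jmax (Ordinal s_lt) isT).
have t0in : Ghat_maximizers r t0 by split => //; rewrite supM supE nt0 natrK.
have t0lb : lbound (Ghat_maximizers r) t0.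
  move=> t [t_01]; rewrite supM supE => gt.
  have [n0|n0] := eqVneq n 0%N.
    by rewrite /t0 n0 invr0 mulr0; case/andP: t_01.
  rewrite ler_pdivrMr ?ltr0n ?lt0n// mulrC.
  apply: (@le_trans _ _ (Num.truncn (n%:R * t : R))%:R).
    by rewrite ler_nat; apply: kmin; rewrite trn//= gt.
  by rewrite truncn_le mulr_ge0//; case/andP: t_01.
by rewrite /= /change_point_estimator (inf_min t0in t0lb).
Qed.

End change_point.

Section linear_model.
Context {R : realType} {H : completeNormedModType R}.
Variable dot : {dot H for (@idfun R)}.

(* {dot H for idfun} provides a symmetric positive definite bilinear form. *)
Definition hilbert_norm := forall x : H, dot x x = `|x| ^+ 2.

Definition residual n (s : n.-tuple (borel H * R)) (a : R) (b : H) (i : 'I_n) :=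
  (tnth s i).2 - a - dot (tnth s i).1 b.

Definition halfspace_class (B : set H) : set (borel H * R -> R) :=
  [set f | exists v b, B b /\ f = fun p => (p.2 <= v + dot p.1 b)%R%:R].

End linear_model.

(* Main.v *)
From HB Require Import structures.
Require Import Defs.
From mathcomp Require Import all_boot all_order all_algebra.
From mathcomp Require Import all_classical all_reals all_analysis.
From mathcomp Require Import measurable_realfun ring lra.
Import Order.TTheory GRing.Theory Num.Theory.
Import numFieldNormedType.Exports.

Set Implicit Arguments.
Unset Strict Implicit.
Unset Printing Implicit Defensive.

Local Open Scope classical_set_scope.
Local Open Scope ring_scope.

(** The residual CUSUM process separates into a signal and a uniformly small
error.  Multiplying out the definition, [Ghat r t z] is a positive factor
depending on n only times [cusum r k z], where k is the integer part of n t and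
[cusum r k z] is #{i < k | r i <= z} / n - (k / n) #{i < n | r i <= z} / n
([Ghat_cusum]).  If the counts were replaced by their means under the model
with known parameters, this would be [peak n m k] * (F1 z - F2 z), where m is
the index of the change and [peak n m] is a tent function of k with its top at
k = m ([cusum_profile]).  As F1 <> F2, the supremum over z of |F1 - F2| is
positive, so a maximizer of sup_z |Ghat| cannot be far from the top of the tent
when the error is small ([argmax_stability]).

It remains to bound the error uniformly in k and z.  With v = z + ahat - alpha
and b = bhat - beta, the event r i <= z is eps i <= v + <X i, b>; whenever b
lies in the class B this is the value at (X i, eps i) of a member of the Donsker
class of half spaces.  Thus the random v and b are dealt with by a law of large
numbers that is uniform over the class, applied separately before and after the
change.
- Weak convergence to a law on bounded functions makes the uniform norm of the
  empirical process bounded in outer probability, so the empirical measure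
  converges uniformly over the class ([donsker_uniform_law]).
- That statement is about the product measure.  By independence, any subfamily
  of the pairs (X i, eps i) whose members have law Q has as its joint law a power
  of Q ([subsample_law]), so the uniform law applies to every block of
  observations on one side of the change ([subsample_deviation]).
- Partial sums, divided by n, move by at most (k' - k) / n between k and k'; it
  is therefore enough to control a number of grid points that does not grow with
  n ([partial_sum_deviation]).
- The integral of the half space indicator is close to F z once ahat - alpha and
  bhat - beta are small, because outside an event of small probability the shift
  <x, b> is small, and F is uniformly continuous ([halfspace_integral_near]).

Since a measure takes unspecified values at sets that are not measurable, the
conclusion also calls for the measurability of the estimator.  It holds because
the estimator is a function of the finitely many comparisons r i <= r j
([measurable_change_point_estimator]). *)

(** * Stability of the maximizer of the CUSUM process *)

Section argmax.
Context {R : realType}.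

Definition partial_count n (r : 'I_n -> R) (k : nat) (z : R) : R :=
  \sum_(i < n | (i < k)%N) (r i <= z)%R%:R.

Definition cusum n (r : 'I_n -> R) (k : nat) (z : R) : R :=
  partial_count r k z / n%:R - k%:R / n%:R * (partial_count r n z / n%:R).

Lemma truncn_le_size n (t : R) : 0 <= t <= 1 -> (Num.truncn (n%:R * t) <= n)%N.
Proof.
move=> /andP[t0 t1]; rewrite -(ler_nat R); apply: (@le_trans _ _ (n%:R * t)).
  by rewrite truncn_le mulr_ge0.
by rewrite ler_piMr.
Qed.

(** With N the counting function, k (n - k) (N_k / k - (N_n - N_k) / (n - k)) is
n N_k - k N_n, which has no denominator that may vanish. *)
Lemma Ghat_cusum n (r : 'I_n -> R) t z : (0 < n)%N -> 0 <= t <= 1 ->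
  Ghat r t z =
  n%:R ^+ 2 / n%:R `^ (3 / 2) * cusum r (Num.truncn (n%:R * t)) z.
Proof.
move=> n0 t01; rewrite /Ghat /cusum; set k := Num.truncn _.
rewrite /Fhat /Ftilde -/(partial_count r k z).
set T := \sum_(i < n | (k <= i)%N) _.
have nE : partial_count r n z = partial_count r k z + T.
  rewrite /partial_count /T (bigID (fun i : 'I_n => (i < k)%N)) /=.
  by congr (_ + _); apply: eq_bigl => i; rewrite ltn_ord// -leqNgt.
have nR : n%:R != 0 :> R by rewrite pnatr_eq0 -lt0n.
have pR : n%:R `^ (3 / 2) != 0 :> R by rewrite gt_eqF// powR_gt0// ltr0n.
have kE : k%:R * (k%:R^-1 * partial_count r k z) = partial_count r k z.
  have [k0|k0] := eqVneq k 0%N; last by rewrite mulVKf// pnatr_eq0.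
  by rewrite k0 mul0r /partial_count big_pred0.
have TE : (n - k)%:R * ((n - k)%:R^-1 * T) = T.
  have [k0|k0] := eqVneq (n - k)%N 0%N; last by rewrite mulVKf// pnatr_eq0.
  rewrite k0 mul0r /T big_pred0// => i; apply/negbTE; rewrite -ltnNge.
  by rewrite (leq_trans (ltn_ord i))// -subn_eq0 k0.
rewrite nE -[in LHS]mulrA mulrBr.
transitivity ((n%:R `^ (3 / 2))^-1 *
    ((n - k)%:R * (k%:R * (k%:R^-1 * partial_count r k z)) -
     k%:R * ((n - k)%:R * ((n - k)%:R^-1 * T)))); first by ring.
rewrite kE TE natrB ?truncn_le_size//; field.
by rewrite nR pR.
Qed.

(** The tent min(k (n - m), m (n - k)) / n ^ 2. *)
Definition peak (n m k : nat) : R :=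
  if (k <= m)%N then k%:R / n%:R * (1 - m%:R / n%:R)
  else m%:R / n%:R * (1 - k%:R / n%:R).

Lemma peak_ge0 n m k : (m <= n)%N -> (k <= n)%N -> 0 <= peak n m k.
Proof.
move=> mn kn.
have le1 j : (j <= n)%N -> 0 <= (j%:R / n%:R : R) <= 1.
  move=> jn; rewrite divr_ge0//=; have [n0|n0] := posnP n.
    by rewrite n0 invr0 mulr0.
  by rewrite ler_pdivrMr ?ltr0n// mul1r ler_nat.
move: (le1 _ mn) (le1 _ kn) => /andP[? ?] /andP[? ?].
by rewrite /peak; case: ifP => _; rewrite mulr_ge0// subr_ge0.
Qed.

(** In the variable k / n, the tent has slope 1 - m / n before m and - m / n after. *)
Lemma peak_gap n m k (d : R) : (0 < n)%N ->
  d <= m%:R / n%:R -> d <= 1 - m%:R / n%:R ->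
  d * `|k%:R / n%:R - m%:R / n%:R| <= peak n m m - peak n m k.
Proof.
move=> n0 dm dm1; rewrite /peak leqnn; case: leqP => km.
  rewrite ler0_norm; last first.
    by rewrite -mulrBl pmulr_lle0 ?invr_gt0 ?ltr0n// subr_le0 ler_nat.
  apply: (@le_trans _ _
    ((1 - m%:R / n%:R) * (m%:R / n%:R - k%:R / n%:R))); last lra.
  rewrite opprB; apply: ler_wpM2r => //.
  by rewrite -mulrBl divr_ge0// subr_ge0 ler_nat.
rewrite ger0_norm; last first.
  by rewrite -mulrBl divr_ge0// subr_ge0 ler_nat ltnW.
apply: (@le_trans _ _ (m%:R / n%:R * (k%:R / n%:R - m%:R / n%:R))); last lra.
apply: ler_wpM2r => //.
by rewrite -mulrBl divr_ge0// subr_ge0 ler_nat ltnW.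
Qed.

Lemma change_point_estimator_itv n (r : 'I_n -> R) :
  0 <= change_point_estimator r <= 1.
Proof. by have [[]] := change_point_estimator_min r. Qed.

Lemma truncn_frac_dist n (t : R) : (0 < n)%N -> 0 <= t ->
  `|t - (Num.truncn (n%:R * t))%:R / n%:R| <= n%:R^-1.
Proof.
move=> n0 t0; have nR : 0 < n%:R :> R by rewrite ltr0n.
have nt0 : 0 <= n%:R * t by rewrite mulr_ge0.
rewrite -(ler_pM2l nR) mulfV ?gt_eqF// -[X in X * `|_|]gtr0_norm// -normrM.
rewrite mulrBr [n%:R * (_ / _)]mulrC divfK ?gt_eqF//.
have /andP[l u] := truncn_itv nt0; rewrite ger0_norm ?subr_ge0//.
by rewrite lerBlDl -[X in _ + X]/(1%:R) -natrD addn1 ltW.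
Qed.

(** Comparing the values of sup_z |cusum| at the maximizer and at m costs the
error eta twice, whereas the tent has dropped by a multiple of the distance. *)
Lemma argmax_stability n (r : 'I_n -> R) m (Delta : R -> R) (eta d : R) :
  (0 < n)%N -> (m <= n)%N ->
  has_ubound [set `|Delta z| | z in [set: R]] ->
  (forall k z, (k <= n)%N -> `|cusum r k z - peak n m k * Delta z| <= eta) ->
  0 < d -> d <= m%:R / n%:R -> d <= 1 - m%:R / n%:R ->
  d * sup [set `|Delta z| | z in [set: R]] *
    `|(Num.truncn (n%:R * change_point_estimator r))%:R / n%:R - m%:R / n%:R|
  <= 2 * eta.
Proof.
move=> n0 mn Dub cusumE d0 dm dm1.
set D := sup _; set t := change_point_estimator r; set k := Num.truncn _.
have nR : 0 < n%:R :> R by rewrite ltr0n.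
have t01 : 0 <= t <= 1 := change_point_estimator_itv r.
have kn : (k <= n)%N := truncn_le_size n t01.
set C := n%:R ^+ 2 / n%:R `^ (3 / 2) : R.
have C0 : 0 < C by rewrite divr_gt0// ?exprn_gt0// powR_gt0.
have DE z : `|Delta z| <= D by apply: ub_le_sup => //; exists z.
have eta0 : 0 <= eta by apply: le_trans (cusumE m 0 mn).
have D0 : 0 <= D by apply: le_trans (DE 0).
have cusum_le j z : (j <= n)%N -> `|cusum r j z| <= peak n m j * D + eta.
  move=> jn; rewrite -[cusum r j z](subrK (peak n m j * Delta z)) addrC.
  apply: (le_trans (ler_normD _ _)); apply: lerD; last exact: cusumE.
  by rewrite normrM ger0_norm ?peak_ge0//; apply: ler_wpM2l; rewrite ?peak_ge0.
have supGhat_le s : 0 <= s <= 1 ->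
    supGhat r s <= C * (peak n m (Num.truncn (n%:R * s)) * D + eta).
  move=> s01; apply: ge_sup; first by exists `|Ghat r s 0|; exists 0.
  move=> _ [z _ <-]; rewrite Ghat_cusum// normrM gtr0_norm//.
  by rewrite ler_pM2l// cusum_le// truncn_le_size.
have peak_le1 j : (j <= n)%N -> peak n m j <= 1.
  move=> jn.
  have le1 i : (i <= n)%N -> 0 <= (i%:R / n%:R : R) <= 1.
    by move=> im; rewrite divr_ge0//= ler_pdivrMr// mul1r ler_nat.
  move: (le1 _ mn) (le1 _ jn) => /andP[? ?] /andP[? ?].
  rewrite /peak; case: ifP => _;
    by rewrite mulr_ile1// ?subr_ge0// lerBlDr lerDl.
have m01 : 0 <= (m%:R / n%:R : R) <= 1.
  by rewrite divr_ge0//= ler_pdivrMr// mul1r ler_nat.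
have mE : Num.truncn (n%:R * (m%:R / n%:R) : R) = m.
  by rewrite mulrC divfK ?gt_eqF// natrK.
have max_t : supGhat r (m%:R / n%:R) <= supGhat r t.
  have [[_ ->] _] := change_point_estimator_min r.
  apply: ub_le_sup; last by exists (m%:R / n%:R) => //=; rewrite in_itv.
  exists (C * (D + eta)) => _ [s /= + <-]; rewrite in_itv /= => s01.
  apply: (le_trans (supGhat_le _ s01)); rewrite ler_pM2l// lerD2r.
  by rewrite ler_piMl// peak_le1// truncn_le_size.
(* The maximality of k enters here: at m the process is no larger than at k. *)
have cusum_m z : `|cusum r m z| <= peak n m k * D + eta.
  rewrite -(ler_pM2l C0); apply: le_trans (supGhat_le _ t01).
  apply: le_trans max_t; rewrite -{1}mE -[X in X * _]gtr0_norm// -normrM.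
  rewrite -Ghat_cusum//; apply: ub_le_sup; last by exists z.
  exists (C * (peak n m m * D + eta)) => _ [y _ <-].
  by rewrite Ghat_cusum// normrM gtr0_norm// ler_pM2l// mE cusum_le.
have peakm : peak n m m * D <= peak n m k * D + 2 * eta.
  have [->|pm] := eqVneq (peak n m m) 0.
    by rewrite mul0r addr_ge0 ?mulr_ge0 ?peak_ge0.
  have pm0 : 0 < peak n m m by rewrite lt_neqAle eq_sym pm peak_ge0.
  rewrite mulrC -ler_pdivlMr//.
  apply: ge_sup; first by exists `|Delta 0|; exists 0.
  move=> _ [z _ <-].
  rewrite ler_pdivlMr// mulrC -[X in X * _]gtr0_norm// -normrM.
  have := ler_normD (peak n m m * Delta z - cusum r m z) (cusum r m z).
  rewrite subrK => /le_trans; apply.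
  have := cusumE m z mn; rewrite distrC; have := cusum_m z; lra.
have gap := peak_gap k n0 dm dm1.
rewrite mulrAC; apply: (@le_trans _ _ ((peak n m m - peak n m k) * D)).
  exact: ler_wpM2r.
lra.
Qed.

End argmax.

Lemma sum_ord_itv1 (R : realType) n a b : (b <= n)%N ->
  \sum_(i < n | (a <= i < b)%N) (1 : R) = (b - a)%:R.
Proof.
move=> bn; rewrite -(big_mkord (fun i => (a <= i < b)%N) (fun=> 1)).
rewrite -[(b - a)%N]muln1 -sum_nat_const_nat natr_sum.
rewrite (big_nat_widen _ _ _ _ _ bn) [RHS](big_nat_widenl _ 0%N)//.
by apply: eq_bigl => i /=; rewrite andbC.
Qed.

Section cusum_profile.
Context {R : realType}.

Lemma partial_count_cat n (r : 'I_n -> R) m k z : (m <= k)%N ->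
  partial_count r k z =
  partial_count r m z + \sum_(i < n | (m <= i < k)%N) (r i <= z)%R%:R.
Proof.
move=> mk; rewrite /partial_count (bigID (fun i : 'I_n => (i < m)%N))/=.
congr (_ + _); apply: eq_bigl => i; last by rewrite -leqNgt andbC.
by case: (ltnP i m) => im; rewrite ?andbF// (leq_trans im mk).
Qed.

(** The mean profile U_k = k F1 for k <= m and m F1 + (k - m) F2 beyond gives
U_k - (k / n) U_n = n [peak n m k] (F1 - F2) on both sides of m.  After the
change a count is the sum of two blocks, hence off by 2 eta, and the CUSUM
process involves two counts. *)
Lemma cusum_profile n m (r : 'I_n -> R) (F1 F2 : R -> R) (eta : R) :
  (0 < n)%N -> (m <= n)%N ->
  (forall k z, (k <= m)%N ->
    `|\sum_(i < n | (i < k)%N) ((r i <= z)%R%:R - F1 z)| <= eta * n%:R) ->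
  (forall k z, (m <= k <= n)%N ->
    `|\sum_(i < n | (m <= i < k)%N) ((r i <= z)%R%:R - F2 z)| <= eta * n%:R) ->
  forall k z, (k <= n)%N ->
    `|cusum r k z - peak n m k * (F1 z - F2 z)| <= 4 * eta.
Proof.
move=> n0 mn before after.
have nR : 0 < n%:R :> R by rewrite ltr0n.
have nR0 : n%:R != 0 :> R by rewrite gt_eqF.
have sum_const (a b : nat) (c : R) : (b <= n)%N ->
    \sum_(i < n | (a <= i < b)%N) c = (b - a)%:R * c.
  move=> bn; rewrite -(sum_ord_itv1 R a bn) mulr_suml.
  by under [RHS]eq_bigr do rewrite mul1r.
have scale (V x : R) : `|V - x| <= eta * n%:R -> `|V / n%:R - x / n%:R| <= eta.
  by rewrite -mulrBl normrM normfV (gtr0_norm nR) ler_pdivrMr.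
pose U k z := partial_count r k z.
have U1 k z : (k <= m)%N -> `|U k z / n%:R - k%:R / n%:R * F1 z| <= eta.
  move=> km; have := before k z km.
  rewrite sumrB (sum_const 0%N)//; last exact: leq_trans mn.
  by rewrite subn0 => /scale; rewrite mulrAC.
have U2 k z : (m <= k <= n)%N ->
    `|U k z / n%:R - m%:R / n%:R * F1 z - (k%:R / n%:R - m%:R / n%:R) * F2 z|
      <= 2 * eta.
  move=> mkn; have /andP[mk kn] := mkn; rewrite /U (partial_count_cat _ _ mk).
  set V := \sum_(i < n | _) _.
  have hV : `|V / n%:R - (k%:R / n%:R - m%:R / n%:R) * F2 z| <= eta.
    have := after k z mkn.
    by rewrite sumrB sum_const// natrB// => /scale; rewrite mulrAC mulrBl.
  have := U1 m z (leqnn m); rewrite /U => hU.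
  have := ler_normD (partial_count r m z / n%:R - m%:R / n%:R * F1 z)
    (V / n%:R - (k%:R / n%:R - m%:R / n%:R) * F2 z).
  rewrite [X in `|X| <= _ -> _](_ : _ = (partial_count r m z + V) / n%:R -
    m%:R / n%:R * F1 z - (k%:R / n%:R - m%:R / n%:R) * F2 z); last by ring.
  by move=> /le_trans; apply; lra.
move=> k z kn.
have kn1 : 0 <= (k%:R / n%:R : R) <= 1.
  by rewrite divr_ge0//= ler_pdivrMr// mul1r ler_nat.
have combine u (c : R) : `|u - c| <= 2 * eta ->
    c - k%:R / n%:R * (m%:R / n%:R * F1 z + (1 - m%:R / n%:R) * F2 z) =
      peak n m k * (F1 z - F2 z) ->
    `|u - k%:R / n%:R * (U n z / n%:R) - peak n m k * (F1 z - F2 z)| <= 4 * eta.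
  move=> uc <-.
  have := U2 n z; rewrite mn leqnn mulfV// => /(_ isT) hn.
  set un := U n z / n%:R in hn *.
  set cn := m%:R / n%:R * F1 z + (1 - m%:R / n%:R) * F2 z.
  have := ler_normB (u - c) (k%:R / n%:R * (un - cn)).
  rewrite [X in `|X| <= _ -> _](_ : _ =
    u - k%:R / n%:R * un - (c - k%:R / n%:R * cn)); last by ring.
  move=> /le_trans; apply.
  have : `|k%:R / n%:R * (un - cn)| <= 2 * eta.
    rewrite normrM ger0_norm; last by case/andP: kn1.
    apply: (@le_trans _ _ (1 * `|un - cn|)).
      by apply: ler_wpM2r => //; case/andP: kn1.
    by rewrite mul1r /cn opprD addrA.
  lra.
rewrite /cusum -/(U k z) -/(U n z).
have [km|/ltnW mk] := leqP k m.
  apply: (combine _ (k%:R / n%:R * F1 z)).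
    have := U1 k z km; have : 0 <= eta by apply: le_trans (U1 k z km).
    lra.
  by rewrite /peak km; ring.
apply: (combine _ (m%:R / n%:R * F1 z + (k%:R / n%:R - m%:R / n%:R) * F2 z)).
  by rewrite opprD addrA; apply: U2; rewrite mk kn.
rewrite /peak; case: leqP => [km|_]; last by ring.
have -> : k = m by apply/eqP; rewrite eqn_leq km mk.
by ring.
Qed.

End cusum_profile.

(** * Measurability of the estimator *)

Section measurability.
Context {R : realType}.

(** A threshold matters only through the largest residual below it. *)
Lemma threshold_transfer n (r r' : 'I_n -> R) :
  (forall i j, (r i <= r j) = (r' i <= r' j)) ->
  forall z, exists z', forall i, (r i <= z) = (r' i <= z').
Proof.
move=> rr' z; case: (pselect (exists i, r i <= z)) => [[i0 i0z]|none].
  have [j jz jmax] := @arg_maxP _ _ 'I_n i0 (fun i => r i <= z) r i0z.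
  exists (r' j) => i; rewrite -rr'; apply/idP/idP => [|/le_trans]; last exact.
  exact: jmax.
exists (- (\sum_i `|r' i|) - 1) => i.
have -> : (r i <= z) = false by apply/negP => iz; apply: none; exists i.
apply/esym/negP => h; have := ler_norm (- r' i); rewrite normrN => h'.
have : `|r' i| <= \sum_i `|r' i|.
  by rewrite (bigD1 i)//= lerDl sumr_ge0.
lra.
Qed.

(** Equally ordered residuals have the same empirical distribution functions up
to a reparametrization of the thresholds, which a supremum over z forgets. *)
Lemma change_point_estimator_order n (r r' : 'I_n -> R) :
  (forall i j, (r i <= r j) = (r' i <= r' j)) ->
  change_point_estimator r = change_point_estimator r'.
Proof.
move=> rr'.
suff E : supGhat r = supGhat r'.
  by rewrite /change_point_estimator /Ghat_maximizers E.
have GE (s s' : 'I_n -> R) z z' t : (forall i, (s i <= z) = (s' i <= z')) ->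
    Ghat s t z = Ghat s' t z'.
  move=> zz'; rewrite /Ghat /Fhat /Ftilde; congr (_ * (_ * _ - _ * _));
  by apply: eq_bigr => i _; rewrite zz'.
apply/funext => t; rewrite /supGhat; congr sup; apply/seteqP.
split=> _ [z _ <-].
  have [z' zz'] := threshold_transfer rr' z.
  by exists z' => //; rewrite (GE _ _ _ _ t zz').
have [z' zz'] := threshold_transfer (fun i j => esym (rr' i j)) z.
by exists z' => //; rewrite (GE _ _ _ _ t zz').
Qed.

(** The comparison matrix takes finitely many values, each on a measurable set,
and the estimator is constant on each of these sets. *)
Lemma measurable_change_point_estimator d (T : measurableType d) n
    (r : 'I_n -> T -> R) : (forall i, measurable_fun setT (r i)) ->
  measurable_fun setT (fun w => change_point_estimator (r ^~ w)).
Proof.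
move=> mr _ Y mY; rewrite setTI.
pose C w := [ffun p : 'I_n * 'I_n => r p.1 w <= r p.2 w].
rewrite [X in measurable X](_ : _ =
    \bigcup_(c in [set C w | w in
        [set w | Y (change_point_estimator (r ^~ w))]]) [set w | C w = c]).
  apply: fin_bigcup_measurable; first exact: finite_finset.
  move=> c _; rewrite (_ : [set w | _] = \bigcap_(p in [set: 'I_n * 'I_n])
      ((fun w => r p.1 w <= r p.2 w) @^-1` [set c p])).
    apply: fin_bigcap_measurable; first exact: finite_finset.
    move=> p _; rewrite -[X in measurable X]setTI.
    exact: (measurable_fun_ler (mr p.1) (mr p.2)).
  apply/seteqP; split=> [w <- p _ /=|w Cw]; first by rewrite ffunE.
  by apply/ffunP => p; rewrite ffunE; exact: Cw.
apply/seteqP; split=> [w Yw|w [c [w' /= Yw' <-] Cw]] /=.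
  by exists (C w) => //; exists w.
rewrite (@change_point_estimator_order _ _ (r ^~ w'))// => i j.
by move/ffunP: Cw => /(_ (i, j)); rewrite !ffunE.
Qed.

End measurability.

(** * Borel measurability in a separable Hilbert space *)

Section borel_measurability.
Context {R : realType}.

Lemma measurable_lt_cst d (T : measurableType d) (h : T -> R) a :
  measurable_fun setT h -> measurable [set w | h w < a].
Proof.
move=> mh; rewrite (_ : [set _ | _] = setT `&` h @^-1` `]-oo, a[).
  by apply: mh => //; exact: measurable_itv.
by rewrite setTI; apply/seteqP; split=> w /=; rewrite in_itv.
Qed.

Lemma measurable_gt_cst d (T : measurableType d) (h : T -> R) a :
  measurable_fun setT h -> measurable [set w | a < h w].
Proof.
move=> mh; rewrite (_ : [set _ | _] = setT `&` h @^-1` `]a, +oo[).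
  by apply: mh => //; exact: measurable_itv.
by rewrite setTI; apply/seteqP; split=> w /=; rewrite in_itv /= andbT.
Qed.

Lemma continuous_borel_measurable (D : ptopologicalType) (h : D -> R) :
  continuous h -> measurable_fun setT (h : borel D -> R).
Proof.
move=> /continuousP ch _.
apply: (measurability _ (RGenOpens.measurableE R)) => // _ [_ [a [b ->] <-]].
by rewrite setTI; apply: sub_sigma_algebra; exact/ch/interval_open.
Qed.

Lemma dense_ball (V : normedModType R) (S : set V) (x : V) (e : R) :
  dense S -> 0 < e -> exists2 q, S q & `|x - q| < e.
Proof.
move=> dS e0; have [] := dS (ball x e).
- by exists x; exact: ballxx.
- exact: ball_open.
- by move=> q [xq Sq]; exists q => //; move: xq; rewrite -ball_normE.
Qed.

Lemma measurable_borel_norm (V : completeNormedModType R) :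
  measurable_fun setT (fun x : borel V => `|x : V|).
Proof. by apply: (@continuous_borel_measurable V); exact: norm_continuous. Qed.

Lemma measurable_borel_normB (V : completeNormedModType R) (q : V) :
  measurable_fun setT (fun x : borel V => `|(x : V) - q|).
Proof.
apply: (@continuous_borel_measurable V (fun x => `|x - q|)) => x.
by apply: cvg_norm; apply: cvgB => //; exact: cvg_cst.
Qed.

(** The addition of V is measurable for the product of the Borel sigma-algebras
only through separability: |x + y| < c amounts to |x - q| < r and |y + q| < c - r
for some q in a countable dense set and some rational r. *)
Lemma measurable_normD (V : completeNormedModType R) d (T : measurableType d)
    (f g : T -> borel V) : separable V ->
  measurable_fun setT f -> measurable_fun setT g ->
  measurable_fun setT (fun w => `|(f w : V) + g w|).
Proof.
move=> [S cS dS] mf mg _.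
apply: (measurability _ (RGenInftyO.measurableE R)) => // _ [_ [c ->] <-].
rewrite setTI (_ : _ @^-1` _ = \bigcup_(q : S) \bigcup_(r : rat)
   ([set w | `|(f w : V) - val q| < ratr r] `&`
    [set w | `|(g w : V) + val q| < c - ratr r])).
  apply: countable_bigcupT_measurable => [|q].
    by rewrite (eq_countable (card_setT S)).
  apply: bigcupT_measurable_rat => r.
  apply: measurableI; apply: measurable_lt_cst.
    exact: (measurableT_comp (measurable_borel_normB _) mf).
  rewrite (_ : (fun w => _) = fun w => `|(g w : V) - (- val q)|).
    exact: (measurableT_comp (measurable_borel_normB _) mg).
  by apply/funext => w; rewrite opprK.
apply/seteqP; split => [w /=|w [q _ [r _ [/= fq gq]]]]; rewrite in_itv /=.
  set e := c - `|(f w : V) + g w|; rewrite -subr_gt0 -/e => e0.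
  have [q Sq fq] := dense_ball (f w) dS (divr_gt0 e0 (ltr0n R 4)).
  have [|r] := @rat_in_itvoo R (e / 4) (e / 2); first lra.
  rewrite in_itv /= => /andP[r1 r2].
  exists (SigSub (mem_set Sq)) => //; exists r => //; split=> /=.
    exact: lt_trans r1.
  have : `|(g w : V) + q| <= `|(f w : V) + g w| + `|(f w : V) - q|.
    rewrite -[`|(f w : V) - q|]normrN; apply: le_trans (ler_normD _ _).
    by rewrite opprB [f w + _]addrC -addrA [f w + _]addrCA subrr addr0.
  rewrite /e in r2 fq *; lra.
have : `|(f w : V) + g w| <= `|(f w : V) - val q| + `|(g w : V) + val q|.
  apply: le_trans (ler_normD _ _).
  by rewrite addrACA [- val q + _]addrC subrr addr0.
lra.
Qed.

Context {H : completeNormedModType R} (dot : {dot H for (@idfun R)}).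
Hypothesis Hnorm : hilbert_norm dot.

Lemma dot_polarization x y :
  dot x y = (`|x + y| ^+ 2 - `|x| ^+ 2 - `|y| ^+ 2) / 2.
Proof.
have C : dot y x = dot x y by rewrite hermC /= expr0 mul1r.
have E z : dot (x + y) z = dot x z + dot y z by exact: (linearDl dot z x y).
by rewrite -!Hnorm linearDr /= !E C; field.
Qed.

Lemma dot_cauchy_schwarz x y : `|dot x y| <= `|x| * `|y|.
Proof.
have half u v : dot u v <= `|u| * `|v|.
  rewrite dot_polarization ler_pdivrMr//.
  have : `|u + v| ^+ 2 <= (`|u| + `|v|) ^+ 2.
    by rewrite ler_pXn2r// ?nnegrE ?addr_ge0// ler_normD.
  lra.
rewrite ler_norml half andbT lerNl -linearNl -[`|x|]normrN.
exact: half.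
Qed.

Lemma measurable_dot d (T : measurableType d) (f g : T -> borel H) :
  separable H -> measurable_fun setT f -> measurable_fun setT g ->
  measurable_fun setT (fun w => dot (f w) (g w)).
Proof.
move=> sH mf mg; under eq_fun do rewrite dot_polarization.
apply: measurable_funM => //.
apply: measurable_funB; first apply: measurable_funB.
- by apply: measurable_funX; exact: measurable_normD.
- apply: measurable_funX; apply: measurableT_comp mf.
  exact: measurable_borel_norm.
- apply: measurable_funX; apply: measurableT_comp mg.
  exact: measurable_borel_norm.
Qed.

End borel_measurability.

(** * From the Donsker property to a uniform law of large numbers *)

Lemma near_lt_cvge (R : realType) (u : nat -> \bar R) l x :
  u n @[n --> \oo] --> l -> (l < x)%E -> \forall n \near \oo, (u n < x)%E.
Proof.
move=> ul lx; apply: (ul [set y | (y < x)%E]).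
by apply: open_nbhs_nbhs; split => //; exact: open_ereal_lt_ereal.
Qed.

Lemma near_gt_cvge (R : realType) (u : nat -> \bar R) l x :
  u n @[n --> \oo] --> l -> (x < l)%E -> \forall n \near \oo, (x < u n)%E.
Proof.
move=> ul lx; apply: (ul [set y | (x < y)%E]).
by apply: open_nbhs_nbhs; split => //; exact: open_ereal_gt_ereal.
Qed.

Lemma measurable_tail_small (R : realType) d (T : measurableType d)
    (mu : probability T R) (h : T -> R) (e : R) : measurable_fun setT h -> 0 < e ->
  exists2 M, 0 <= M & (mu [set x | M < h x]%R < e%:E)%E.
Proof.
move=> mh e0; pose A k := [set x | k%:R < h x].
have mA k : measurable (A k) by exact: measurable_gt_cst.
have capA : \bigcap_k A k = set0.
  apply/seteqP; split=> // x /(_ (Num.truncn `|h x|).+1 Logic.I).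
  have /andP[_ /ltW hx] := truncn_itv (normr_ge0 (h x)).
  by rewrite /A /= ltNge (le_trans (ler_norm _)).
have := @nonincreasing_cvg_mu _ _ _ mu A _ mA _ _.
rewrite capA measure0.
have -> : (mu (A 0%N) < +oo)%E.
  by apply: le_lt_trans (probability_le1 _ _) _; rewrite ?ltry.
have Ahomo : {homo A : n m / (n <= m)%N >-> (m <= n)%O}.
  move=> i j ij; apply/subsetPset => z; apply: le_lt_trans.
  by rewrite ler_nat.
move=> /(_ isT measurable0 Ahomo) Acvg.
have [|N _ /(_ N (leqnn N)) AN] := near_lt_cvge Acvg (x := e%:E).
  by rewrite lte_fin.
by exists N%:R.
Qed.

Section uniform_norm.
Context {R : realType} {I : choiceType}.
Implicit Types z y : ell_infty R I.

Definition uniform_norm z : R := sup [set `|set_val z i| | i in [set: I]].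

Lemma ell_infty_bounded z : has_ubound [set `|set_val z i| | i in [set: I]].
Proof.
have /set_mem [M [_ MP]] := valP z.
by exists (M + 1) => _ [i _ <-]; apply: (MP (M + 1)) => //; rewrite ltrDl.
Qed.

Lemma uniform_norm_ub z i : `|set_val z i| <= uniform_norm z.
Proof. by apply: ub_le_sup; [exact: ell_infty_bounded|exists i]. Qed.

Lemma uniform_norm_le z M : 0 <= M -> (forall i, `|set_val z i| <= M) ->
  uniform_norm z <= M.
Proof.
move=> M0 zM; rewrite /uniform_norm.
have [-> | ne] := eqVneq [set `|set_val z i| | i in [set: I]] set0.
  by rewrite sup0.
apply: ge_sup; first exact/set0P.
by move=> _ [i _ <-].
Qed.

Lemma uniform_norm_ge0 z : 0 <= uniform_norm z.
Proof.
rewrite /uniform_norm.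
have [-> | /set0P[_ [i _ _]]] := eqVneq [set `|set_val z i| | i in [set: I]] set0.
  by rewrite sup0.
exact: le_trans (uniform_norm_ub z i).
Qed.

Lemma uniform_norm_continuous : continuous uniform_norm.
Proof.
move=> z; have FF : Filter (nbhs z) by exact: nbhs_filter.
apply/(@cvgrPdist_le _ _ _ _ FF) => /= e e0.
have near_z : nbhs (set_val z : {uniform I -> R})
    [set y : {uniform I -> R} | forall i, `|set_val z i - y i| < e].
  apply/uniform_nbhs; exists [set p : R * R | `|p.1 - p.2| < e]; split.
    exact: (@entourage_ball _ R (PosNum e0)).
  by move=> y /= zy i; exact: zy.
have := @initial_continuous _ _
  (set_val : ell_infty R I -> {uniform I -> R}) z _ near_z.
apply: (@filterS _ _ FF) => y /= zy.
have near (u v : ell_infty R I) : (forall i, `|set_val u i - set_val v i| <= e) ->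
    uniform_norm u <= uniform_norm v + e.
  move=> uv; apply: uniform_norm_le.
    by rewrite addr_ge0 ?uniform_norm_ge0// ltW.
  move=> i; rewrite -[set_val u i](subrK (set_val v i)) addrC.
  apply: (le_trans (ler_normD _ _)); apply: lerD (uv i); exact: uniform_norm_ub.
rewrite ler_distlC; apply/andP; split.
  by rewrite lerBlDr; apply: near => i; apply: ltW.
by apply: near => i; rewrite distrC ltW.
Qed.

End uniform_norm.

Section donsker_uniform_law.
Context {d} {T : measurableType d} {R : realType} (P : probability T R).

(** Markov's inequality for outer expectations; Z need not be measurable, so its
exceptional set is enclosed in a measurable one. *)
Lemma outer_expectation_lt (Z : T -> R) (e : R) : (forall x, 0 <= Z x) ->
  (outer_expectation P Z < e%:E)%E ->
  exists A, [/\ measurable A, (P A <= e%:E)%E & forall x, ~ A x -> Z x < 1].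
Proof.
move=> Z0 /ereal_inf_lt[_ [U [iU ZU] <-] Ue].
have U0 x : (0 <= U x)%E by apply: le_trans (ZU x); rewrite lee_fin.
have mU := measurable_int P iU.
pose A := [set x | (1 <= U x)%E].
have mA : measurable A.
  rewrite -[A]setTI; apply: emeasurable_fun_c_infty => //.
exists A; split => //.
  apply: le_trans (ltW Ue); rewrite -(setIT A) -integral_indic//.
  apply: ge0_le_integral => //.
  - by apply/measurable_EFinP; exact: measurable_indic.
  - move=> x _; rewrite indicE.
    by case: (boolP (x \in A)) => [xA|_]; [exact: set_mem xA|exact: U0].
move=> x; rewrite /A /= => /negP; rewrite -ltNge -lte_fin.
exact: le_lt_trans (ZU x).
Qed.

End donsker_uniform_law.

Section uniform_norm_tail.
Context {R : realType} {I : choiceType}.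

(** Weak convergence is tested against bounded continuous functions: this one lies
between the indicators of uniform_norm z >= M + 1 and of uniform_norm z > M. *)
Definition norm_excess (M : R) (z : ell_infty R I) : R :=
  Num.min 1 (Num.max 0 (uniform_norm z - M)).

Lemma norm_excess_continuous M : continuous (norm_excess M).
Proof.
move=> z; apply: (@continuous_comp _ _ _ uniform_norm
  (fun x : R => Num.min 1 (Num.max 0 (x - M)))).
  exact: uniform_norm_continuous.
apply: continuous_min; first exact: cvg_cst.
apply: continuous_max; first exact: cvg_cst.
by apply: cvgB; [exact: cvg_id|exact: cvg_cst].
Qed.

Lemma norm_excess_itv M z : 0 <= norm_excess M z <= 1.
Proof. by rewrite /norm_excess le_min ler01 le_max lexx ge_min lexx. Qed.

Lemma norm_excess_lt1 M z : norm_excess M z < 1 -> uniform_norm z < M + 1.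
Proof. by rewrite /norm_excess gt_min ltxx/= gt_max ltr01/= ltrBlDl. Qed.

Lemma norm_excess_integral_small (mu : probability (borel (ell_infty R I)) R)
    (e : R) : 0 < e ->
  exists2 M, 0 <= M & (\int[mu]_z (norm_excess M z)%:E < e%:E)%E.
Proof.
move=> e0.
have mnorm := continuous_borel_measurable (@uniform_norm_continuous R I).
have [M M0 Msmall] := measurable_tail_small mu mnorm e0.
pose A := [set z : borel (ell_infty R I) | M < uniform_norm z].
have mA : measurable A by exact: measurable_gt_cst.
exists M => //; apply: le_lt_trans Msmall; rewrite -/A -[A]setIT.
rewrite -integral_indic//; apply: ge0_le_integral => //.
- by move=> z _; rewrite lee_fin; case/andP: (norm_excess_itv M z).
- apply/measurable_EFinP; apply: continuous_borel_measurable.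
  exact: norm_excess_continuous.
- by apply/measurable_EFinP; exact: measurable_indic.
- move=> z _; rewrite lee_fin indicE; case: (boolP (z \in A)) => [_|/negP zA].
    by case/andP: (norm_excess_itv M z).
  rewrite /norm_excess ge_min ge_max lexx/= subr_le0; apply/orP; right.
  by rewrite leNgt; apply/negP => h; apply: zA; apply/mem_set.
Qed.

End uniform_norm_tail.

(** The limit of the outer expectations of [norm_excess M] is small for M large, so
with outer probability close to 1 the empirical process stays below M + 1, and
the deviation of the empirical measure below (M + 1) / sqrt n. *)
Lemma donsker_uniform_law d (T : measurableType d) (R : realType)
    (P : probability T R) (F : set (T -> R)) : donsker P F ->
  forall e : R, 0 < e -> \forall n \near \oo, exists A : set (n.-tuple T),
    [/\ measurable A, (power_probability P n A <= e%:E)%E &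
      forall s, ~ A s -> forall f, F f ->
        `|n%:R^-1 * (\sum_(i < n) f (tnth s i)) - \int[P]_x f x| <= e].
Proof.
move=> [_ [G [mu [GE Gcvg _]]]] e e0.
have [M M0 excess_small] := norm_excess_integral_small mu e0.
have := Gcvg (norm_excess M) (@norm_excess_continuous _ _ M).
have bM : bounded_fun (norm_excess M : ell_infty R F -> R).
  exists 1; split=> // x x1 z _ /=; have /andP[z0 z1] := norm_excess_itv M z.
  by rewrite ger0_norm// (le_trans z1)// ltW.
move=> /(_ bM) /near_lt_cvge /(_ excess_small) Glt.
near=> n.
have [||A [mA PA AZ]] := @outer_expectation_lt _ _ _ (power_probability P n)
  (norm_excess M \o G n) e.
- by move=> s /=; case/andP: (norm_excess_itv M (G n s)).
- by near: n; exact: Glt.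
exists A; split=> // s /AZ /norm_excess_lt1 Gs f Ff.
have sn0 : 0 < Num.sqrt n%:R :> R.
  by rewrite sqrtr_gt0 ltr0n; near: n; exact: nbhs_infty_gt.
rewrite -(ler_pM2l sn0) -[X in X * `|_|]gtr0_norm// -normrM.
rewrite -/(empirical_process P s f) -(GE n s (SigSub (mem_set Ff))).
apply: (le_trans (uniform_norm_ub _ _)); apply: (le_trans (ltW Gs)).
rewrite -ler_pdivrMr//.
have M1 : 0 <= (M + 1) / e by rewrite divr_ge0 ?addr_ge0// ltW.
rewrite -[leLHS]ger0_norm// -sqrtr_sqr ler_sqrt//; near: n.
exact: nbhs_infty_ger.
Unshelve. all: end_near. Qed.

(** * The joint law of a subsample *)

Section independence.
Context {d} {T : measurableType d} {R : realType} (P : probability T R).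

(** The product rule is about the whole family; taking the full set as the
event of every index outside the range of g turns it into one for g. *)
Lemma mutually_independent_inj (I J : finType) (g : J -> I)
    (G : I -> set_system T) :
  injective g -> (forall i, G i setT) ->
  mutually_independent P G -> mutually_independent P (G \o g).
Proof.
move=> ginj GT Gind A GA.
pose B i := if [pick j | g j == i] is Some j then A j else setT.
have Bg j : B (g j) = A j.
  rewrite /B; case: pickP => [j' /eqP/ginj -> //|/(_ j)].
  by rewrite eqxx.
have BT i : i \notin codom g -> B i = setT.
  rewrite /B; case: pickP => [j /eqP <-|//]; by rewrite codom_f.
have GB i : G i (B i).
  by rewrite /B; case: pickP => [j /eqP <-|_]; [exact: GA|exact: GT].
have -> : \bigcap_j A j = \bigcap_i B i.
  apply/seteqP; split=> w h i _; last by rewrite -Bg; exact: h.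
  have [/codomP[j ->]|/BT -> //] := boolP (i \in codom g).
  by rewrite Bg; exact: h.
rewrite Gind// (bigID [in codom g])/= [X in (_ * X)%E]big1 ?mule1; last first.
  by move=> i /BT ->; rewrite probability_setT.
rewrite (eq_bigl [in g @: [set: J]%SET]); last first.
  move=> i; apply/codomP/imsetP => [[j ->]|[j _ ->]]; last by exists j.
  by exists j; rewrite ?inE.
rewrite big_imset/=; last by move=> ? ? _ _; exact: ginj.
by apply: eq_big => [j|j _]; [rewrite finset.in_setT|rewrite Bg].
Qed.

Lemma g_sigma_preimage_bigcap d' (T' : measurableType d') n m (f : 'I_n -> T -> T')
    (g : 'I_m -> 'I_n) (a : 'I_m -> set T') : (forall j, measurable (a j)) ->
  g_sigma_preimage f (\bigcap_j (f (g j) @^-1` a j)).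
Proof.
move=> ma; pose G := \big[setU/set0]_(i < n) preimage_set_system setT (f i) measurable.
suff : measurable (\bigcap_j (f (g j) @^-1` a j) : set (g_sigma_algebraType G)) by [].
apply: fin_bigcap_measurable; first exact: finite_finset.
move=> j _; apply: sub_sigma_algebra; rewrite /G -bigcup_seq.
exists (g j); first by rewrite /= mem_index_enum.
by exists (a j) => //; rewrite setTI.
Qed.

End independence.

Section tuple_of_pairs.
Context {d1 d2} {T1 : measurableType d1} {T2 : measurableType d2} {R : realType}.

Definition pair_box n (a : 'I_n -> set T1) (b : 'I_n -> set T2) :
    set (n.-tuple (T1 * T2)) :=
  [set s | forall i, a i (tnth s i).1 /\ b i (tnth s i).2].

Definition pair_boxes n : set_system (n.-tuple (T1 * T2)) :=
  [set A | exists a b, [/\ forall i, measurable (a i),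
    forall i, measurable (b i) & A = pair_box a b]].

(** The coordinates of the coordinates are measurable for the sigma-algebra
generated by the boxes, and hence so is the identity map. *)
Lemma measurable_pair_boxes n :
  measurable = <<s @pair_boxes n >>.
Proof.
apply/seteqP; split=> A.
  pose G := @pair_boxes n.
  have mid : measurable_fun setT
      (id : g_sigma_algebraType G -> n.-tuple (T1 * T2)%type).
    apply/measurable_fun_tnthP => i; apply/measurable_fun_pairP; split=> _ a ma;
      rewrite setTI; apply: sub_sigma_algebra.
      exists (fun j => if j == i then a else setT), (fun=> setT).
      split=> // [j|]; first by case: ifP.
      apply/seteqP; split=> s /=; first by move=> ha j; case: ifP => // /eqP ->.
      by move=> /(_ i) []; rewrite eqxx.
    exists (fun=> setT), (fun j => if j == i then a else setT).
    split=> // [j|]; first by case: ifP.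
    apply/seteqP; split=> s /=; first by move=> ha j; case: ifP => // /eqP ->.
    by move=> /(_ i) []; rewrite eqxx.
  by move=> mA; have := mid measurableT A mA; rewrite setTI.
apply: smallest_sub; first exact: sigma_algebra_measurable.
move=> _ [a [b [ma mb ->]]].
rewrite (_ : pair_box a b = \bigcap_(i in [set: 'I_n])
  ((fun s : n.-tuple (T1 * T2) => tnth s i) @^-1` (a i `*` b i))).
  apply: fin_bigcap_measurable => // i _.
  rewrite -[X in measurable X]setTI; apply: measurable_tnth => //.
  exact: measurableX.
by apply/seteqP; split=> s /= h i; [move=> _|]; exact: h.
Qed.

Lemma pair_boxes_unique n (mu nu : probability (n.-tuple (T1 * T2)) R) :
  (forall a b, (forall i, measurable (a i)) -> (forall i, measurable (b i)) ->
    mu (pair_box a b) = nu (pair_box a b)) ->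
  forall A, measurable A -> mu A = nu A.
Proof.
move=> munu; apply: (@measure_unique _ _ _ (@pair_boxes n) (fun=> setT)).
- exact: measurable_pair_boxes.
- move=> _ _ [a [b [ma mb ->]]] [a' [b' [ma' mb' ->]]].
  exists (fun i => a i `&` a' i), (fun i => b i `&` b' i).
  split; [by move=> i; exact: measurableI..|].
  apply/seteqP; split=> s /=; first by move=> [h h'] i; case: (h i); case: (h' i).
  by move=> h; split=> i; case: (h i) => -[? ?] [].
- by move=> _; exists (fun=> setT), (fun=> setT); split=> //; apply/seteqP; split.
- exact: bigcup_const.
- by move=> _ [a [b [ma mb ->]]]; exact: munu.
- by move=> k; apply: le_lt_trans (probability_le1 mu _) _; rewrite ?ltry.
Qed.

End tuple_of_pairs.

Section sample_law.
Context {d d1 d2} {Omega : measurableType d} {R : realType} 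
  (P : probability Omega R) {T1 : measurableType d1} {T2 : measurableType d2} {n : nat}
  (X : 'I_n -> {RV P >-> T1}) (Y : 'I_n -> {RV P >-> T2}).
Hypotheses (Xind : mutually_independent P (fun i => g_sigma_algebra_preimage (X i)))
  (Yind : mutually_independent P (fun i => g_sigma_algebra_preimage (Y i)))
  (XYind : independent P (g_sigma_preimage (fun i => X i : Omega -> T1))
                         (g_sigma_preimage (fun i => Y i : Omega -> T2))).

Definition subsample m (g : 'I_m -> 'I_n) w : m.-tuple (T1 * T2) :=
  [tuple (X (g j) w, Y (g j) w) | j < m].

Lemma measurable_subsample m (g : 'I_m -> 'I_n) : measurable_fun setT (subsample g).
Proof.
apply/measurable_fun_tnthP => j; rewrite /subsample.
rewrite (_ : _ \o _ = fun w => (X (g j) w, Y (g j) w)); last first.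
  by apply/funext => w /=; rewrite tnth_mktuple.
exact: measurable_fun_pair.
Qed.

(** Both laws are determined by boxes of rectangles.  There the independence of the
X's from the Y's, and that within each family, split the probability into
factors, which recombine to Q (a j x b j) by independence of X (g j) and
Y (g j). *)
Lemma subsample_law m (g : 'I_m -> 'I_n) (Q : probability (T1 * T2)%type R) :
  injective g ->
  (forall j A, measurable A -> P [set w | A (X (g j) w, Y (g j) w)] = Q A) ->
  forall A, measurable A -> P (subsample g @^-1` A) = power_probability Q m A.
Proof.
move=> ginj lawQ.
pose Z : {mfun Omega >-> m.-tuple (T1 * T2)%type} :=
  HB.pack (subsample g)
    (isMeasurableFun.Build _ _ _ _ _ (measurable_subsample g)).
apply: (@pair_boxes_unique _ _ _ _ _ m (distribution P Z)
  (power_probability Q m)).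
move=> a b ma mb.
have prei d' (T' : measurableType d') (f : {mfun Omega >-> T'}) c : measurable c ->
    g_sigma_algebra_preimage f (f @^-1` c) by move=> mc; exists c => //; rewrite setTI.
have prei0 d' (T' : measurableType d') (f : {mfun Omega >-> T'}) :
    g_sigma_algebra_preimage f setT by exists setT => //; rewrite setTI.
have indX := mutually_independent_inj ginj (fun i => prei0 _ _ (X i)) Xind.
have indY := mutually_independent_inj ginj (fun i => prei0 _ _ (Y i)) Yind.
transitivity (\prod_j Q (a j `*` b j))%E; last first.
  by apply/esym/power_probability_box => j; exact: measurableX.
transitivity (P (subsample g @^-1` pair_box a b)); first by [].
rewrite (_ : _ @^-1` _ =
  \bigcap_j (X (g j) @^-1` a j) `&` \bigcap_j (Y (g j) @^-1` b j)).
  rewrite XYind; [|exact: (@g_sigma_preimage_bigcap _ _ _ _ _ _ X g)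
                  |exact: (@g_sigma_preimage_bigcap _ _ _ _ _ _ Y g)].
  rewrite indX; last by move=> j; exact: prei.
  rewrite indY; last by move=> j; exact: prei.
  rewrite -big_split/=; apply: eq_bigr => j _.
  rewrite -(lawQ j); last exact: measurableX.
  rewrite [RHS](_ : _ = P (X (g j) @^-1` a j `&` Y (g j) @^-1` b j))//.
  (* A single event is the intersection of a family indexed by 'I_1. *)
  have cst d' (T' : measurableType d') (f : 'I_n -> Omega -> T') (c : set T') :
      measurable c -> g_sigma_preimage f (f (g j) @^-1` c).
    move=> mc; have := @g_sigma_preimage_bigcap _ _ _ _ _ 1 f
      (fun=> g j) (fun=> c) (fun=> mc).
    by rewrite bigcap_const//; exists ord0.
  apply/esym/XYind; first exact: (cst _ _ (fun i => X i : Omega -> T1)).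
  exact: (cst _ _ (fun i => Y i : Omega -> T2)).
apply/seteqP; split=> w /=.
  by move=> h; split=> j _; have := h j; rewrite tnth_mktuple => -[].
by move=> [h h'] j; rewrite tnth_mktuple; split=> /=; [exact: h|exact: h'].
Qed.

End sample_law.

(** * Events of asymptotically full probability *)

Section asymptotically_sure.
Context {d} {T : measurableType d} {R : realType} (P : probability T R).

(** The events of interest involve a supremum over an uncountable class and need
not be measurable, hence the measurable exceptional set B. *)
Definition asymptotically_sure (A : nat -> set T) :=
  forall e : R, 0 < e -> \forall n \near \oo,
    exists B, [/\ measurable B, (P B <= e%:E)%E & ~` B `<=` A n].

Lemma asymptotically_sureS (A B : nat -> set T) :
  (\forall n \near \oo, A n `<=` B n) ->
  asymptotically_sure A -> asymptotically_sure B.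
Proof.
move=> AB sA e e0; near=> n.
have [|C [mC PC CA]] := near (sA e e0) n; first by [].
exists C; split=> //; apply: subset_trans CA _.
by near: n.
Unshelve. all: end_near. Qed.

Lemma asymptotically_sureI (A B : nat -> set T) :
  asymptotically_sure A -> asymptotically_sure B ->
  asymptotically_sure (fun n => A n `&` B n).
Proof.
move=> sA sB e e0; have e2 : 0 < e / 2 by rewrite divr_gt0.
near=> n.
have [|C [mC PC CA]] := near (sA _ e2) n; first by [].
have [|D [mD PD DB]] := near (sB _ e2) n; first by [].
exists (C `|` D); split; first exact: measurableU.
  apply: le_trans (measureU2 _ mC mD) _.
  by rewrite [e]splitr EFinD; exact: leeD.
by rewrite setCU => w [/CA ? /DB].
Unshelve. all: end_near. Qed.

Lemma asymptotically_sure_bigcap J (A : 'I_J -> nat -> set T) :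
  (forall j, asymptotically_sure (A j)) ->
  asymptotically_sure (fun n => \bigcap_j A j n).
Proof.
elim: J A => [|J IH] A sA.
  move=> e e0; near=> n; exists set0.
  split=> //; first by rewrite measure0 lee_fin ltW.
  by move=> w _ [].
apply: asymptotically_sureS
  (asymptotically_sureI (sA ord0) (IH _ (fun j => sA (lift ord0 j)))).
near=> n => w [w0 wS] j _.
by case: (unliftP ord0 j) => [i ->|-> //]; exact: wS.
Unshelve. all: end_near. Qed.

Lemma asymptotically_sure_cvg1 (A : nat -> set T) : (forall n, measurable (A n)) ->
  P (A n) @[n --> \oo] --> 1%E -> asymptotically_sure A.
Proof.
move=> mA PA e e0; near=> n.
exists (~` A n); split; [exact: measurableC| |by rewrite setCK].
rewrite probability_setC// leeBlDr ?fin_num_measure// -leeBlDl//.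
rewrite -EFinB; apply: ltW; near: n.
by apply: near_gt_cvge PA _; rewrite lte_fin ltrBlDr ltrDl.
Unshelve. all: end_near. Qed.

Lemma asymptotically_sure_little_o (Z : nat -> T -> R) (e : R) :
  (forall n, measurable_fun setT (Z n)) -> little_o_P P Z -> 0 < e ->
  asymptotically_sure (fun n => [set w | `|Z n w| <= e]).
Proof.
move=> mZ oZ e0 r r0; near=> n.
exists [set w | e < `|Z n w|]; split.
- by apply: measurable_gt_cst; exact: measurableT_comp.
- apply: ltW; near: n; apply: near_lt_cvge (oZ e e0) _.
  by rewrite lte_fin.
- by move=> w /= /negP; rewrite -leNgt.
Unshelve. all: end_near. Qed.

Lemma little_o_asymptotically_sure (Z : nat -> T -> R) :
  (forall n, measurable_fun setT (Z n)) ->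
  (forall e : R, 0 < e -> asymptotically_sure (fun n => [set w | `|Z n w| <= e])) ->
  little_o_P P Z.
Proof.
move=> mZ sZ e e0; apply/fine_cvgP; split.
  near=> n; apply: fin_num_measure.
  by apply: measurable_gt_cst; exact: measurableT_comp.
apply/cvgrPdist_le => r r0; near=> n; rewrite sub0r normrN ger0_norm ?fine_ge0//.
have mE : measurable [set w | e < `|Z n w|].
  by apply: measurable_gt_cst; exact: measurableT_comp.
have [|B [mB PB BZ]] := near (sZ e e0 r r0) n; first by [].
rewrite -lee_fin fineK ?fin_num_measure//; apply: le_trans PB.
apply: le_measure; rewrite ?inE// => w /= Zw.
by apply: contrapT => /BZ /=; rewrite leNgt Zw.
Unshelve. all: end_near. Qed.

End asymptotically_sure.

(** * Uniform deviations of partial sums *)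

Lemma Rintegral_itv01 d (T : measurableType d) (R : realType)
    (P : probability T R) (f : T -> R) :
  P.-integrable setT (EFin \o f) -> (forall x, 0 <= f x <= 1) ->
  0 <= \int[P]_x f x <= 1.
Proof.
move=> fi f01; rewrite Rintegral_ge0//=; last by move=> x _; case/andP: (f01 x).
have -> : 1 = \int[P]_x (1 : R).
  by rewrite Rintegral_cst//= [P setT]probability_setT mulr1.
apply: le_Rintegral => //; last by move=> x _; case/andP: (f01 x).
exact: finite_measure_integrable_cst.
Qed.

Section uniform_partial_sums.
Context {d d1 d2} {Omega : measurableType d} {R : realType}
  (P : probability Omega R) {T1 : measurableType d1} {T2 : measurableType d2}
  (X : forall n, 'I_n -> {RV P >-> T1}) (Y : forall n, 'I_n -> {RV P >-> T2}).
Arguments X : clear implicits.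
Arguments Y : clear implicits.
Hypotheses
  (Xind : forall n,
    mutually_independent P (fun i => g_sigma_algebra_preimage (X n i)))
  (Yind : forall n,
    mutually_independent P (fun i => g_sigma_algebra_preimage (Y n i)))
  (XYind : forall n, independent P (g_sigma_preimage (fun i => X n i : Omega -> T1))
                         (g_sigma_preimage (fun i => Y n i : Omega -> T2))).
Context (Q : probability (T1 * T2)%type R) (F : set ((T1 * T2)%type -> R)).
Hypotheses (F01 : forall f, F f -> forall x, 0 <= f x <= 1) (FQ : donsker Q F).

Lemma deviation_le1 f x : F f -> `|f x - \int[Q]_y f y| <= 1.
Proof.
move=> Ff; have /andP[f0 f1] := F01 Ff x.
have /andP[i0 i1] := Rintegral_itv01 (FQ.1 f Ff) (F01 Ff).
by rewrite ler_norml; apply/andP; split; lra.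
Qed.

(** A large subsample obeys the uniform law of large numbers; a bounded one is
negligible against e n because its terms are bounded by 1. *)
Lemma subsample_deviation (S : forall n, {set 'I_n}) (e : R) :
  (forall n i A, i \in S n -> measurable A ->
    P [set w | A (X n i w, Y n i w)] = Q A) -> 0 < e ->
  asymptotically_sure P (fun n => [set w | forall f, F f ->
    `|\sum_(i in S n) (f (X n i w, Y n i w) - \int[Q]_x f x)| <= e * n%:R]).
Proof.
move=> SQ e0 r r0; pose e' := Num.min e r.
have e'0 : 0 < e' by rewrite lt_min e0 r0.
have [N _ lawN] := donsker_uniform_law FQ e'0.
near=> n.
have [Slt|Sge] := ltnP #|S n| N.
  exists set0; split=> //; first by rewrite measure0 lee_fin ltW.
  move=> w _ f Ff; apply: (le_trans (ler_norm_sum _ _ _)).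
  apply: (@le_trans _ _ (\sum_(i in S n) 1)).
    by apply: ler_sum => i _; exact: deviation_le1.
  rewrite sumr_const (@le_trans _ _ N%:R)//.
    by rewrite ler_nat ltnW.
  by rewrite mulrC -ler_pdivrMr//; near: n; exact: nbhs_infty_ger.
have [A [mA PA Adev]] := lawN _ Sge.
pose g := @enum_val _ (mem (S n)).
have law := @subsample_law _ _ _ _ _ _ _ _ _ (X n) (Y n)
  (@Xind n) (@Yind n) (@XYind n) #|S n| g Q enum_val_inj
  (fun j B mB => SQ n _ B (enum_valP j) mB) A mA.
exists (subsample (X n) (Y n) g @^-1` A); split.
- by rewrite -[X in measurable X]setTI; exact: measurable_subsample.
- apply: (@le_trans _ _ e'%:E); last by rewrite lee_fin ge_min lexx orbT.
  by have := PA; rewrite -law.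
move=> w /= /Adev dev f Ff.
have := dev f Ff; rewrite [\sum_(i in S n) _]big_enum_val/=.
set s := #|S n|.
have [s0 _|s0] := posnP s.
  rewrite big1 ?normr0 ?mulr_ge0 ?(ltW e0)// => i _.
  by have := ltn_ord i; rewrite [X in (_ < X)%N]s0.
have sR : 0 < s%:R :> R by rewrite ltr0n.
move=> h; apply: (@le_trans _ _ (s%:R * e')); last first.
  rewrite [leRHS]mulrC; apply: ler_pM => //; first exact: ltW.
    by rewrite ler_nat -[leqRHS]card_ord max_card.
  by rewrite ge_min lexx.
have := ler_wpM2l (ltW sR) h.
rewrite -{1}(gtr0_norm sR) -normrM mulrBr mulVKf ?gt_eqF//.
rewrite sumrB sumr_const card_ord !mulr_natl.
under eq_bigr do rewrite tnth_mktuple.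
exact.
Unshelve. all: end_near. Qed.

(** For J > 4 / e grid points at spacing q = n / J + 1, every k is within q of a grid
point below it, and the terms in between contribute at most q <= e n / 2 when n
is large. *)
Lemma partial_sum_deviation (s t : nat -> nat) (e : R) :
  (forall n, s n <= t n <= n)%N ->
  (forall n (i : 'I_n) A, (s n <= i < t n)%N -> measurable A ->
    P [set w | A (X n i w, Y n i w)] = Q A) -> 0 < e ->
  asymptotically_sure P (fun n => [set w |
    forall k, (s n <= k <= t n)%N -> forall f, F f ->
    `|\sum_(i < n | (s n <= i < k)%N) (f (X n i w, Y n i w) - \int[Q]_x f x)|
      <= e * n%:R]).
Proof.
move=> stn stQ e0; have e2 : 0 < e / 2 by rewrite divr_gt0.
have e4 : 0 < e / 4 by rewrite divr_gt0.
pose J := (Num.truncn (e / 4)^-1).+1.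
have JR : J%:R^-1 <= e / 4.
  rewrite -[leRHS]invrK lef_pV2 ?posrE ?ltr0n// ?invr_gt0//.
  have /andP[_ /ltW] := @truncn_itv R (e / 4)^-1 ltac:(by rewrite invr_ge0 ltW).
  exact.
pose q n := (n %/ J).+1.
pose b (j : 'I_J) n := minn (s n + j * q n) (t n).
pose S j n := [set i : 'I_n | (s n <= i < b j n)%N]%SET.
have sure j : asymptotically_sure P (fun n => [set w | forall f, F f ->
    `|\sum_(i in S j n) (f (X n i w, Y n i w) - \int[Q]_x f x)| <= e / 2 * n%:R]).
  apply: subsample_deviation => // n i A.
  rewrite inE leq_min => /andP[si /andP[_ it]] mA.
  by apply: stQ => //; rewrite si.
apply: asymptotically_sureS (asymptotically_sure_bigcap sure).
near=> n => w sumw k /andP[sk kt] f Ff.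
have /andP[_ tn] := stn n.
have n0 : 0 < n%:R :> R by rewrite ltr0n; near: n; exact: nbhs_infty_gt.
have jJ : ((k - s n) %/ q n < J)%N.
  rewrite ltn_divLR// /q mulnC (leq_ltn_trans _ (ltn_ceil n _))//.
  by rewrite (leq_trans (leq_subr _ _))// (leq_trans kt).
pose j := Ordinal jJ.
have bE : b j n = (s n + (k - s n) %/ q n * q n)%N.
  apply/minn_idPl; apply: leq_trans kt.
  by rewrite -leq_subRL// leq_trunc_div.
have bk : (b j n <= k)%N by rewrite bE -leq_subRL// leq_trunc_div.
have sb : (s n <= b j n)%N by rewrite bE leq_addr.
have kb : (k - b j n <= q n)%N.
  by rewrite bE subnDA {1}(divn_eq (k - s n) (q n)) addKn ltnW ?ltn_pmod.
rewrite (bigID (fun i : 'I_n => (i < b j n)%N))/=.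
apply: (le_trans (ler_normD _ _)).
rewrite [e]splitr mulrDl; apply: lerD.
  rewrite (eq_bigl [in S j n]); first exact: sumw.
  by move=> i; rewrite inE -andbA; case: (ltnP i (b j n)) => //= ib;
    rewrite ?andbF// (leq_trans ib bk).
apply: (le_trans (ler_norm_sum _ _ _)).
apply: (@le_trans _ _ (\sum_(i < n | (b j n <= i < k)%N) 1)).
  rewrite [leRHS](eq_bigl
      (fun i : 'I_n => (s n <= i < k)%N && ~~ (i < b j n)%N)); last first.
    move=> i; rewrite -leqNgt.
    case: (leqP (b j n) i) => bi /=; rewrite ?andbF//.
    by rewrite andbT (leq_trans sb bi).
  by apply: ler_sum => i _; exact: deviation_le1.
rewrite sum_ord_itv1 ?(leq_trans kt)//.
apply: (@le_trans _ _ (n%:R / J%:R + 1)).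
  rewrite (@le_trans _ _ (q n)%:R) ?ler_nat//.
  rewrite /q -natr1 lerD2r ler_pdivlMr ?ltr0n// -natrM ler_nat leq_trunc_div//.
have -> : e / 2 * n%:R = n%:R * (e / 4) + e / 4 * n%:R by field.
rewrite lerD ?ler_pM2l// mulrC -ler_pdivrMr//.
by near: n; exact: nbhs_infty_ger.
Unshelve. all: end_near. Qed.

End uniform_partial_sums.

(** * Half space probabilities near the true parameters *)

Section halfspace_integral.
Context {R : realType}.

Lemma hoelder_modulus (g c : R) (F : R -> R) (e : R) : 0 < g ->
  hoelder_continuous g c F -> 0 < e ->
  exists2 h, 0 < h & forall x y, `|x - y| <= h -> `|F x - F y| <= e.
Proof.
move=> g0 Fh e0; have c0 : 0 < `|c| + 1 by rewrite ltr_wpDl.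
have ec0 : 0 < e / (`|c| + 1) by rewrite divr_gt0.
exists ((e / (`|c| + 1)) `^ g^-1); first exact: powR_gt0.
move=> x y xy; apply: (le_trans (Fh x y)).
apply: (@le_trans _ _ ((`|c| + 1) * `|x - y| `^ g)).
  apply: ler_wpM2r; first exact: powR_ge0.
  by apply: (le_trans (ler_norm c)); rewrite lerDl.
rewrite mulrC -ler_pdivlMr//.
have := ge0_ler_powR (ltW g0) _ _ xy.
rewrite -powRrM mulVf ?gt_eqF// powRr1 ?(ltW ec0)//.
by apply; rewrite nnegrE// powR_ge0.
Qed.

Context {H : completeNormedModType R} (dot : {dot H for (@idfun R)}).
Hypotheses (Hnorm : hilbert_norm dot) (Hsep : separable H).

(** On |x| <= M, Cauchy-Schwarz bounds the shift a + <x, b> by (1 + M) times the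
bound on |a| and |b|, so the half space is squeezed between e <= z - h and
e <= z + h up to the event |x| > M. *)
Lemma halfspace_integral_near (Q : probability (borel H * R)%type R) (g c : R)
    (F : R -> R) (e : R) : 0 < g -> hoelder_continuous g c F ->
  (forall z, Q [set p | p.2 <= z] = (F z)%:E) -> 0 < e ->
  exists2 h, 0 < h & forall (a : R) (b : H) z, `|a| <= h -> `|b| <= h ->
    `|\int[Q]_p (p.2 <= z + a + dot p.1 b)%R%:R - F z| <= e.
Proof.
move=> g0 Fh QF e0; have e2 : 0 < e / 2 by rewrite divr_gt0.
have [h h0 Fe] := hoelder_modulus g0 Fh e2.
have mnorm : measurable_fun setT (fun p : borel H * R => `|p.1 : H|).
  exact: (measurableT_comp (@measurable_borel_norm _ H) measurable_fst).
have [M M0 tailM] := measurable_tail_small Q mnorm e2.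
pose D := [set p : borel H * R | M < `|p.1 : H|].
have mtail : measurable D.
  exact: measurable_gt_cst.
have M1 : 0 < 1 + M by rewrite ltr_wpDr.
exists (h / (1 + M)); first by rewrite divr_gt0.
move=> a b z ah bh.
pose C := [set p : borel H * R | p.2 <= z + a + dot p.1 b].
have mle (u v : borel H * R -> R) :
    measurable_fun setT u -> measurable_fun setT v ->
    measurable [set p | u p <= v p].
  move=> mu mv; rewrite [X in measurable X](_ : _ = ~` [set p | 0 < u p - v p]).
    apply: measurableC; apply: measurable_gt_cst.
    exact: measurable_funB.
  by apply/seteqP; split=> p /=; rewrite subr_gt0 leNgt => /negP.
have mC : measurable C.
  apply: mle => //; apply: measurable_funD => //.
  exact: measurable_dot.
have mz y : measurable [set p : borel H * R | p.2 <= y] by exact: mle.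
have -> : \int[Q]_p (p.2 <= z + a + dot p.1 b)%R%:R = fine (Q C).
  rewrite /Rintegral -[C]setIT -integral_indic//; congr fine.
  apply: eq_integral => p _; rewrite indicE.
  suff -> : (p \in C) = (p.2 <= z + a + dot p.1 b) by [].
  by apply/idP/idP; rewrite inE.
have shift (p : borel H * R) : `|p.1 : H| <= M -> `|a + dot p.1 b| <= h.
  move=> pM; apply: (le_trans (ler_normD _ _)).
  apply: (@le_trans _ _ (h / (1 + M) + M * (h / (1 + M)))); last first.
    by rewrite -{1}[h / _]mul1r -mulrDl mulrC divfK// gt_eqF.
  apply: lerD => //; apply: (le_trans (dot_cauchy_schwarz Hnorm _ _)).
  exact: ler_pM.
have Q2 (A B : set (borel H * R)) :
    measurable A -> measurable B -> A `<=` B `|` D ->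
    (Q A <= Q B + (e / 2)%:E)%E.
  move=> mA mB AB; apply: (@le_trans _ _ (Q (B `|` D))).
    by apply: le_measure; rewrite ?inE//; exact: measurableU.
  apply: (le_trans (measureU2 Q mB mtail)); apply: leeD => //; exact: ltW.
have upper : fine (Q C) <= F (z + h) + e / 2.
  rewrite -lee_fin fineK ?fin_num_measure// EFinD -QF; apply: Q2 => // p Cp.
  have [pM|pM] := leP `|p.1 : H| M; [left|by right].
  have /ler_normlP[_ ap] := shift p pM; rewrite /C /= in Cp *; lra.
have lower : F (z - h) <= fine (Q C) + e / 2.
  rewrite -lee_fin EFinD fineK ?fin_num_measure// -QF; apply: Q2 => // p /= zp.
  have [pM|pM] := leP `|p.1 : H| M; [left|by right].
  have /ler_normlP[ap _] := shift p pM; rewrite /C /=; lra.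
have up_h : `|(z + h) - z| <= h by rewrite addrC addKr gtr0_norm.
have low_h : `|z - (z - h)| <= h by rewrite opprB addrC subrK gtr0_norm.
have /ler_normlP[_ F_up] := Fe _ _ up_h.
have /ler_normlP[_ F_low] := Fe _ _ low_h.
apply/ler_normlP; split; lra.
Qed.

End halfspace_integral.

(** * Consistency of the estimator *)

Theorem lemma4p2 (R : realType)
  (H : completeNormedModType R) (dot : {dot H for (@idfun R)})
  (Hnorm : hilbert_norm dot) (Hsep : separable H)
  (d : measure_display) (Omega : measurableType d) (P : probability Omega R)
  (vartheta : R) (hvartheta : 0 < vartheta < 1)
  (F1 F2 : R -> R) (gamma1 gamma2 c1 c2 : R)
  (alpha : R) (beta : H)
  (X : forall n, 'I_n -> {RV P >-> borel H})
  (Y eps : forall n, 'I_n -> {RV P >-> R})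
  (alphahat : forall n, {mfun n.-tuple (borel H * R)%type >-> R})
  (betahat : forall n, {mfun n.-tuple (borel H * R)%type >-> borel H})
  (P1 P2 : probability (borel H * R)%type R) :
  let k n := Num.truncn (n%:R * vartheta) in
  let data n w := [tuple (X n i w, Y n i w) | i < n] in
  let ahat n w := alphahat n (data n w) in
  let bhat n w := betahat n (data n w) : H in
  let varthetahat n w :=
    change_point_estimator (residual dot (data n w) (ahat n w) (bhat n w)) in
  (forall n i w, Y n i w = alpha + dot (X n i w) beta + eps n i w) ->
  (forall n, mutually_independent P (fun i => g_sigma_algebra_preimage (X n i))) ->
  (forall n i j, identically_distributed (X n i) (X n j)) ->
  (forall n i, P.-integrable setT (fun w => `|X n i w : H|%:E)) ->
  (forall n, mutually_independent P (fun i => g_sigma_algebra_preimage (eps n i))) ->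
  (forall n i, P.-integrable setT (EFin \o eps n i) /\ ('E_P[eps n i] = 0)%E) ->
  (forall n, independent P (g_sigma_preimage (fun i => X n i : Omega -> borel H))
                           (g_sigma_preimage (fun i => eps n i : Omega -> R))) ->
  little_o_P P (fun n w => `|ahat n w - alpha|) ->
  little_o_P P (fun n w => `|bhat n w - beta|) ->
  (forall n (i : 'I_n) z, (i < k n)%N -> cdf (eps n i) z = (F1 z)%:E) ->
  (forall n (i : 'I_n) z, (k n <= i)%N -> cdf (eps n i) z = (F2 z)%:E) ->
  F2 <> F1 ->
  0 < gamma1 <= 1 -> 0 < gamma2 <= 1 ->
  hoelder_continuous gamma1 c1 F1 -> hoelder_continuous gamma2 c2 F2 ->
  (forall n (i : 'I_n) A, (i < k n)%N -> measurable A ->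
    P [set w | A (X n i w, eps n i w)] = P1 A) ->
  (forall n (i : 'I_n) A, (k n <= i)%N -> measurable A ->
    P [set w | A (X n i w, eps n i w)] = P2 A) ->
  (forall Q : probability (borel H * R)%type R, Q = P1 \/ Q = P2 ->
    exists B : set H,
    [/\ forall n, measurable [set w | B (bhat n w - beta)],
        P [set w | B (bhat n w - beta)] @[n --> \oo] --> 1%E
      & donsker Q (halfspace_class dot B)]) ->
  little_o_P P (fun n w => `|varthetahat n w - vartheta|).
Proof.
move=> k data ahat bhat vhat Ymodel Xind Xid Xint epsind epsint XYind oa ob
  cdf1 cdf2 F12 g1 g2 hF1 hF2 law1 law2 don.
have /andP[th0 th1] := hvartheta.
have th01 : 0 <= vartheta <= 1 by rewrite !ltW.
have kn n : (k n <= n)%N by exact: truncn_le_size.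
have nth0 n : 0 <= n%:R * vartheta :> R by rewrite mulr_ge0// ltW.
have m_le z : measurable [set p : borel H * R | p.2 <= z].
  rewrite (_ : [set p | _] = snd @^-1` `]-oo, z]).
    by rewrite -[X in measurable X]setTI; exact: measurable_snd.
  by apply/seteqP; split=> w /=; rewrite in_itv.
have cdfQ n (i : 'I_n) (Q : probability (borel H * R)%type R) (F : R -> R) z :
    (forall A, measurable A -> P [set w | A (X n i w, eps n i w)] = Q A) ->
    cdf (eps n i) z = (F z)%:E -> Q [set p | p.2 <= z] = (F z)%:E.
  move=> lawQ <-; rewrite -lawQ.
    transitivity (P (eps n i @^-1` `]-oo, z])); last by [].
    by congr (P _); apply/seteqP; split=> w /=; rewrite in_itv.
  exact: m_le.
have P1E z : P1 [set p | p.2 <= z] = (F1 z)%:E.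
  have k0 : (0 < k (Num.truncn vartheta^-1).+1)%N.
    rewrite /k truncn_gt0 -ler_pdivrMr//  mul1r.
    have /andP[_ /ltW] := @truncn_itv R vartheta^-1 ltac:(by rewrite invr_ge0 ltW).
    exact.
  pose i : 'I_(Num.truncn vartheta^-1).+1 := ord0.
  by apply: (@cdfQ _ i); [move=> A; exact: law1|exact: cdf1].
have P2E z : P2 [set p | p.2 <= z] = (F2 z)%:E.
  have k1 : (k 1 <= 0)%N.
    have k1 : (k 1%N)%:R <= 1%:R * vartheta by rewrite /k truncn_le nth0.
    by rewrite -ltnS -(ltr_nat R) (le_lt_trans k1)// mul1r.
  pose i : 'I_1 := ord0.
  by apply: (@cdfQ _ i); [move=> A; apply: law2|apply: cdf2].
have F1_itv z : 0 <= F1 z <= 1.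
  by rewrite -!lee_fin -P1E measure_ge0 probability_le1//; exact: m_le.
have F2_itv z : 0 <= F2 z <= 1.
  by rewrite -!lee_fin -P2E measure_ge0 probability_le1//; exact: m_le.
have mdata n : measurable_fun setT (data n).
  exact: (@measurable_subsample _ _ _ _ _ _ _ _ _ (X n) (Y n) n id).
have mahat n : measurable_fun setT (ahat n).
  exact: (measurableT_comp (measurable_funPT (alphahat n)) (mdata n)).
have mbhat n : measurable_fun setT (bhat n : Omega -> borel H).
  exact: (measurableT_comp (measurable_funPT (betahat n)) (mdata n)).
have mvhat n : measurable_fun setT (vhat n).
  apply: measurable_change_point_estimator => i.
  rewrite /residual; under eq_fun do rewrite tnth_mktuple/=.
  apply: measurable_funB; first exact: measurable_funB.
  exact: measurable_dot.
pose Delta z := F1 z - F2 z.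
have Dub : has_ubound [set `|Delta z| | z in [set: R]].
  exists 1 => _ [z _ <-]; have := F1_itv z; have := F2_itv z.
  move=> /andP[? ?] /andP[? ?]; rewrite /Delta ler_norml; apply/andP; split; lra.
set D := sup [set `|Delta z| | z in [set: R]].
have D0 : 0 < D.
  have [z Fz] : exists z, F1 z != F2 z.
    apply: contrapT => /forallNP noz; apply: F12; apply/funext => z.
    by apply/esym/eqP/negPn/negP; exact: noz.
  apply: lt_le_trans (ub_le_sup Dub _); last by exists z.
  by rewrite normr_gt0 subr_eq0.
apply: little_o_asymptotically_sure => [n|e e0].
  by apply: measurableT_comp => //; apply: measurable_funB.
(* A lower bound for both slopes of the tent, for n large. *)
pose c := Num.min (vartheta / 2) (1 - vartheta).
have c0 : 0 < c by rewrite lt_min divr_gt0//= subr_gt0.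
(* Each count is off by 2 eta, one eta from the deviation of the partial sums and
   one from the estimated parameters; [cusum_profile] and [argmax_stability]
   turn this into c * D * distance <= 16 eta, that is distance <= e / 2. *)
pose eta := e * c * D / 32.
have eta0 : 0 < eta by rewrite !(mulr_gt0, divr_gt0).
have [[g1_0 _] [g2_0 _]] := (andP g1, andP g2).
have [h1 h1_0 near1] := halfspace_integral_near Hnorm Hsep g1_0 hF1 P1E eta0.
have [h2 h2_0 near2] := halfspace_integral_near Hnorm Hsep g2_0 hF2 P2E eta0.
pose h := Num.min h1 h2.
have h0 : 0 < h by rewrite lt_min h1_0.
have [B1 [mB1 PB1 don1]] := don P1 (or_introl erefl).
have [B2 [mB2 PB2 don2]] := don P2 (or_intror erefl).
have class01 B f : halfspace_class dot B f -> forall x, 0 <= f x <= 1.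
  by move=> [v [b [_ ->]]] x; rewrite ler0n lern1 leq_b1.
have sB1 := asymptotically_sure_cvg1 mB1 PB1.
have sB2 := asymptotically_sure_cvg1 mB2 PB2.
have sa : asymptotically_sure P (fun n => [set w | `|(`|ahat n w - alpha|)| <= h]).
  apply: asymptotically_sure_little_o => // n.
  by apply: measurableT_comp => //; apply: measurable_funB.
have sb : asymptotically_sure P (fun n => [set w | `|(`|bhat n w - beta|)| <= h]).
  apply: asymptotically_sure_little_o => // n.
  exact: (measurableT_comp (@measurable_borel_normB _ H beta) (mbhat n)).
have sdev1 := @partial_sum_deviation _ _ _ _ _ _ _ _ X eps Xind epsind XYind P1 _
  (class01 B1) don1 (fun=> 0%N) k eta kn law1 eta0.
have sdev2 := @partial_sum_deviation _ _ _ _ _ _ _ _ X eps Xind epsind XYind P2 _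
  (class01 B2) don2 k id eta.
have {}sdev2 := sdev2 (fun n => introT andP (conj (kn n) (leqnn n))).
have {}sdev2 := sdev2 (fun n i A ki => law2 n i A (proj1 (andP ki))) eta0.
apply: asymptotically_sureS (asymptotically_sureI (asymptotically_sureI sB1 sB2)
  (asymptotically_sureI (asymptotically_sureI sa sb) (asymptotically_sureI sdev1 sdev2))).
near=> n => w [[/= B1w B2w] [[/= aw bw] [/= dev1 dev2]]].
have n0 : (0 < n)%N by near: n; exact: nbhs_infty_gt.
have nR : 0 < n%:R :> R by rewrite ltr0n.
pose r := residual dot (data n w) (ahat n w) (bhat n w).
pose v z := z + (ahat n w - alpha).
pose f z (p : borel H * R) : R := (p.2 <= v z + dot p.1 (bhat n w - beta))%R%:R.
have rE i z : (r i <= z)%R%:R = f z (X n i w, eps n i w).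
  rewrite /f /r /residual tnth_mktuple /= Ymodel linearBr /= /v.
  by rewrite -subr_ge0 -[in RHS]subr_ge0; congr ((0 <= _)%R%:R); ring.
have mean_shift (Q : probability (borel H * R)%type R) F a b z : (b <= n)%N ->
    `|\sum_(i < n | (a <= i < b)%N) (f z (X n i w, eps n i w) - \int[Q]_p f z p)|
      <= eta * n%:R ->
    `|\int[Q]_p f z p - F z| <= eta ->
    `|\sum_(i < n | (a <= i < b)%N) ((r i <= z)%R%:R - F z)| <= 2 * eta * n%:R.
  move=> bn dev QF.
  under eq_bigr do rewrite rE -(subrK (\int[Q]_p f z p) (f z _)) -addrA.
  rewrite big_split/=; apply: (le_trans (ler_normD _ _)).
  rewrite -mulrA mulr_natl mulr2n; apply: lerD => //.
  apply: (le_trans (ler_norm_sum _ _ _)).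
  apply: (@le_trans _ _ (\sum_(i < n | (a <= i < b)%N) 1 * eta)).
    by apply: ler_sum => i _; rewrite mul1r.
  rewrite -mulr_suml sum_ord_itv1// mulrC ler_pM2l// ler_nat.
  exact: leq_trans (leq_subr _ _) bn.
have [ah1 ah2] : `|ahat n w - alpha| <= h1 /\ `|ahat n w - alpha| <= h2.
  by move: aw; rewrite normr_id le_min => /andP.
have [bh1 bh2] : `|bhat n w - beta| <= h1 /\ `|bhat n w - beta| <= h2.
  by move: bw; rewrite normr_id le_min => /andP.
have before j z : (j <= k n)%N ->
    `|\sum_(i < n | (i < j)%N) ((r i <= z)%R%:R - F1 z)| <= 2 * eta * n%:R.
  move=> jk; apply: (mean_shift P1 F1 0%N j) => //; first exact: leq_trans (kn n).
    by apply: dev1 => //; exists (v z), (bhat n w - beta).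
  exact: near1.
have after j z : (k n <= j <= n)%N ->
    `|\sum_(i < n | (k n <= i < j)%N) ((r i <= z)%R%:R - F2 z)| <= 2 * eta * n%:R.
  move=> kj; apply: (mean_shift P2 F2); first by case/andP: kj.
    by apply: dev2 => //; exists (v z), (bhat n w - beta).
  exact: near2.
have profile := cusum_profile n0 (kn n) before after.
have kth : (k n)%:R / n%:R <= vartheta.
  by rewrite ler_pdivrMr// mulrC truncn_le.
have kdist := truncn_frac_dist n0 (ltW th0).
have n_th : n%:R^-1 <= vartheta / 2.
  rewrite -[leRHS]invrK lef_pV2 ?posrE ?invr_gt0 ?divr_gt0//.
  by near: n; exact: nbhs_infty_ger.
have n_e : n%:R^-1 <= e / 4.
  rewrite -[leRHS]invrK lef_pV2 ?posrE ?invr_gt0 ?divr_gt0//.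
  by near: n; exact: nbhs_infty_ger.
have ck : c <= (k n)%:R / n%:R.
  apply: (@le_trans _ _ (vartheta / 2)); first by rewrite ge_min lexx.
  by move: kdist => /ler_normlP[_]; lra.
have ck1 : c <= 1 - (k n)%:R / n%:R.
  apply: (@le_trans _ _ (1 - vartheta)); first by rewrite ge_min lexx orbT.
  by rewrite lerD2l lerN2.
have stab := argmax_stability n0 (kn n) Dub profile c0 ck ck1.
have vdist : `|vhat n w - (Num.truncn (n%:R * vhat n w))%:R / n%:R| <= n%:R^-1.
  by apply: truncn_frac_dist => //; case/andP: (change_point_estimator_itv r).
rewrite /= normr_id.
set x := (Num.truncn (n%:R * vhat n w))%:R / n%:R in vdist *.
have xk : `|x - (k n)%:R / n%:R| <= e / 2.
  rewrite -(ler_pM2l (mulr_gt0 c0 D0)); apply: le_trans stab _.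
  by rewrite /eta; lra.
have dist1 := ler_distD x (vhat n w) vartheta.
have dist2 := ler_distD ((k n)%:R / n%:R) x vartheta.
by rewrite distrC in kdist; lra.
Unshelve. all: end_near. Qed.
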